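(* Let $k$ be an algebraically closed field of characteristic $0$. Every even Płoski curve in $\mathbb{P}^2_k$ is strictly semi-stable, and every odd Płoski curve in $\mathbb{P}^2_k$ is unstable.
   Context: An even Płoski curve is a curve of degree $2n$ ($n\ge1$) having $n$ irreducible components, which are smooth conics passing through a common point $P$ and intersecting each other pairwise at $P$ with multiplicity $4$. An odd Płoski curve is a curve of degree $2n+1$ ($n\ge1$) having $n$ irreducible components that are smooth conics passing through a common point $P$ and intersecting each other pairwise at $P$ with multiplicity $4$, and whose remaining irreducible component is a line tangent at $P$ to all the other irreducible components. (Both kinds of curves are reduced.) GIT stability is with respect to the natural action of $SL_3(k)$ on the vector space of homogeneous polynomials of degree $d$ in $x,y,z$ (and its projectivization): a degree $d$ curve $C=V(h)$ is semi-stable if $0$ is not in the closure of the orbit $SL_3\cdot h$; it is stable if the orbit $SL_3\cdot h$ is closed and the stabilizer of $h$ is finite; it is strictly semi-stable if it is semi-stable but not stable; it is unstable if it is not semi-stable. *)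

(* Defs.v *)
From HB Require Import structures.
From mathcomp Require Import all_boot all_order all_algebra.
From mathcomp.multinomials Require Export mpoly.

Set Implicit Arguments.
Unset Strict Implicit.
Unset Printing Implicit Defensive.

Import GRing.Theory.
Local Open Scope ring_scope.

Section ZariskiClosure.
Variables (k : fieldType) (V : vectType k).

(* Polynomial functions on V are polynomials in the coordinates with respect
   to a basis; the resulting topology does not depend on the basis. *)
Definition polyfun_eval (F : {mpoly k[\dim {:V}]}) (v : V) : k :=
  F.@[fun i => coord (vbasis {:V}) i v].

Definition zariski_closure (S : V -> Prop) (v : V) : Prop :=
  forall F : {mpoly k[\dim {:V}]},
    (forall s, S s -> polyfun_eval F s = 0) -> polyfun_eval F v = 0.

Definition zariski_closed (S : V -> Prop) : Prop :=
  forall v, zariski_closure S v -> S v.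

End ZariskiClosure.

Section PlaneCurves.
Variable k : fieldType.

Definition ternary_form (d : nat) := dhomog 3 k d.

(* (A . h)(v) = h (A^-1 v), for column vectors v. *)
Definition mx_act (A : 'M[k]_3) (h : {mpoly k[3]}) : {mpoly k[3]} :=
  h \mPo [tuple \sum_(j < 3) invmx A i j *: 'X_j | i < 3].

Definition SL3_orbit (d : nat) (h : ternary_form d) (g : ternary_form d) : Prop :=
  exists2 A : 'M[k]_3, \det A = 1 & mpoly_of_dhomog g = mx_act A h.

Definition finite_SL3_stabilizer (d : nat) (h : ternary_form d) : Prop :=
  exists s : seq 'M[k]_3,
    forall A : 'M[k]_3, \det A = 1 -> mx_act A h = h -> A \in s.

Definition semistable (d : nat) (h : ternary_form d) : Prop :=
  ~ zariski_closure (SL3_orbit h) 0.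

Definition stable (d : nat) (h : ternary_form d) : Prop :=
  zariski_closed (SL3_orbit h) /\ finite_SL3_stabilizer h.

Definition strictly_semistable (d : nat) (h : ternary_form d) : Prop :=
  semistable h /\ ~ stable h.

Definition unstable (d : nat) (h : ternary_form d) : Prop := ~ semistable h.

(* A point of the projective plane is given by a nonzero row vector P of
   homogeneous coordinates. *)
Definition on_curve (P : 'rV[k]_3) (f : {mpoly k[3]}) : Prop := f.@[P 0] = 0.

(* Over an algebraically closed field it is enough to test k-points. *)
Definition smooth_curve (f : {mpoly k[3]}) : Prop :=
  forall P : 'rV[k]_3, P != 0 -> on_curve P f ->
    exists i : 'I_3, (f^`M(i)).@[P 0] != 0.

Definition smooth_conic (q : {mpoly k[3]}) : Prop :=
  [/\ q != 0, q \is 2.-homog & smooth_curve q].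

Definition line (l : {mpoly k[3]}) : Prop := l != 0 /\ l \is 1.-homog.

(* The equation of the tangent line at a smooth point P of f = 0. *)
Definition tangent_form (f : {mpoly k[3]}) (P : 'rV[k]_3) : {mpoly k[3]} :=
  \sum_(i < 3) (f^`M(i)).@[P 0] *: 'X_i.

Definition tangent_line_at (P : 'rV[k]_3) (l f : {mpoly k[3]}) : Prop :=
  on_curve P f /\ exists2 c : k, c != 0 & l = c *: tangent_form f P.

Definition irreducible_mpoly (f : {mpoly k[3]}) : Prop :=
  [/\ f != 0, f \isn't a GRing.unit &
      forall a b, f = a * b -> a \is a GRing.unit \/ b \is a GRing.unit].

(* The curve h = 0 is reduced, and its distinct irreducible components are
   the curves Q i = 0. *)
Definition reduced_with_components (I : finType) (Q : I -> {mpoly k[3]})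
    (h : {mpoly k[3]}) : Prop :=
  [/\ forall i, irreducible_mpoly (Q i),
      forall i j, i != j -> forall c : k, Q i != c *: Q j &
      exists2 c : k, c != 0 & h = c *: \prod_i Q i].

(* The local ring of the projective plane at P, inside k(x, y, z). *)
Definition local_ring (P : 'rV[k]_3) (x : {fraction {mpoly k[3]}}) : Prop :=
  exists (d : nat) (a b : {mpoly k[3]}),
    [/\ a \is d.-homog, b \is d.-homog, b.@[P 0] != 0 & x = tofrac a / tofrac b].

(* The ideal of local_ring P cut out by f = g = 0, that is, the degree 0 part
   of the localization at P of the homogeneous ideal (f, g). *)
Definition local_ideal (P : 'rV[k]_3) (f g : {mpoly k[3]})
    (x : {fraction {mpoly k[3]}}) : Prop :=
  exists (d : nat) (a b u v : {mpoly k[3]}),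
    [/\ a = u * f + v * g, a \is d.-homog, b \is d.-homog, b.@[P 0] != 0
      & x = tofrac a / tofrac b].

(* The quotient of local_ring P by local_ideal P f g has dimension m over k:
   the classes of the e i form a basis. *)
Definition intersection_multiplicity (P : 'rV[k]_3) (f g : {mpoly k[3]})
    (m : nat) : Prop :=
  exists e : 'I_m -> {fraction {mpoly k[3]}},
    (forall i, local_ring P (e i)) /\
    (forall x, local_ring P x ->
       exists! c : 'rV[k]_m,
         local_ideal P f g (x - \sum_(i < m) tofrac (c 0 i)%:MP * e i)).

Definition hyperosculating_conics (n : nat) (P : 'rV[k]_3)
    (Q : 'I_n -> {mpoly k[3]}) : Prop :=
  [/\ forall i, smooth_conic (Q i),
      forall i, on_curve P (Q i) &
      forall i j, i != j -> intersection_multiplicity P (Q i) (Q j) 4].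

Definition even_ploski (n : nat) (h : ternary_form (2 * n)) : Prop :=
  (1 <= n)%N /\
  exists (P : 'rV[k]_3) (Q : 'I_n -> {mpoly k[3]}),
    [/\ P != 0, hyperosculating_conics P Q & reduced_with_components Q h].

Definition odd_ploski (n : nat) (h : ternary_form (2 * n + 1)) : Prop :=
  (1 <= n)%N /\
  exists (P : 'rV[k]_3) (Q : 'I_n -> {mpoly k[3]}) (l : {mpoly k[3]}),
    [/\ P != 0, hyperosculating_conics P Q,
        line l /\ (forall i, tangent_line_at P l (Q i)) &
        reduced_with_components (oapp Q l) h].

End PlaneCurves.

(* Main.v *)
Require Import Defs.
From mathcomp Require Import all_boot all_order all_algebra all_fingroup.
From mathcomp Require Import ring zify.

(* Choose coordinates in which one of the conics is xz = y^2 and P = (1 : 0 : 0).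
   Contact of order 4 at P then forces every other conic to be a multiple of
   xz - y^2 + b z^2: a form of degree 2 whose restriction to the first conic
   vanishes to order m < 4 cuts out a local ring of dimension at most m.

   The torus diag(1/t, 1, t) fixes xz - y^2 and multiplies z by t.  As t tends to
   0 it takes the equation z prod (xz - y^2 + b_i z^2) of an odd curve to 0, and
   the equation of an even curve to (xz - y^2)^n.  The determinant of the
   catalecticant (d^(a+b) h), with a and b ranging over the monomials of degree n,
   is multiplied by the square of a multiplicative function of the matrix under a
   linear substitution, hence its sixth power is SL_3-invariant.  It does not
   vanish at (xz - y^2)^n, which is equivalent to (x^2 + y^2 + z^2)^n: there the
   catalecticant is, up to a constant, the Gram matrix of the monomials of degree
   n for the standard Gaussian measure.  So even curves are semi-stable.  They are
   not stable, because a one-parameter unipotent group fixes both xz - y^2 and z. *)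

Set Implicit Arguments.
Unset Strict Implicit.
Unset Printing Implicit Defensive.

Import Order.TTheory GRing.Theory Num.Theory.
Local Open Scope ring_scope.

(** * Linear substitutions and the apolar pairing *)

Section LinearSubstitution.
Variables (k : fieldType) (n : nat).
Implicit Types (p q f : {mpoly k[n]}) (A B : 'M[k]_n) (m : 'X_{1..n}).

(** An induction suited to substitutions, derivatives and the apolar pairing, all linear and
    computable on a product with one variable. *)
Lemma mpoly_var_ind (P : {mpoly k[n]} -> Prop) :
    P 1 -> (forall c p q, P p -> P q -> P (c *: p + q)) ->
    (forall i p, P p -> P ('X_i * p)) ->
  forall p, P p.
Proof.
move=> P1 PD PX.
have P0 : P 0 by rewrite -(addNr (1 : {mpoly k[n]})) -scaleN1r; apply: PD.
have PXm m q : P q -> P ('X_[m] * q).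
  move: q; rewrite mpolyXE_id.
  pose K (x : {mpoly k[n]}) := forall q, P q -> P (x * q).
  apply: (big_ind K) => [q|x y Kx Ky q Pq|i _]; first by rewrite mul1r.
    by rewrite -mulrA; apply/Kx/Ky.
  elim: (m i) => [|e IHe] q Pq; first by rewrite expr0 mul1r.
  by rewrite exprS -mulrA; apply/PX/IHe.
apply: mpolyind => // c m p _ _ Pp; apply: PD => //.
by rewrite -['X_[m]]mulr1; apply: PXm.
Qed.

(** Substituting these forms turns [p] into [p(A v)] for column vectors [v]: a right action.
    [mx_act A] substitutes [lin_forms (invmx A)]. *)
Definition lin_forms A : n.-tuple {mpoly k[n]} :=
  [tuple \sum_(j < n) A i j *: 'X_j | i < n].

Lemma tnth_lin_forms A i : tnth (lin_forms A) i = \sum_(j < n) A i j *: 'X_j.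
Proof. by rewrite tnth_mktuple. Qed.

Lemma comp_lin_formsX A i : 'X_i \mPo lin_forms A = \sum_(j < n) A i j *: 'X_j.
Proof. by rewrite comp_mpolyXU -tnth_nth tnth_lin_forms. Qed.

Lemma comp_mpolyM l (lq : n.-tuple {mpoly k[l]}) :
  {morph comp_mpoly lq : p q / p * q}.
Proof. exact: rmorphM. Qed.

Lemma comp_mpoly_sum l (lq : n.-tuple {mpoly k[l]}) (I : Type) (r : seq I)
    (F : I -> {mpoly k[n]}) :
  (\sum_(i <- r) F i) \mPo lq = \sum_(i <- r) (F i \mPo lq).
Proof. exact: (raddf_sum (comp_mpoly lq)). Qed.

Let compP A c p q :
  (c *: p + q) \mPo lin_forms A = c *: (p \mPo lin_forms A) + (q \mPo lin_forms A).
Proof. exact: linearP. Qed.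

Lemma comp_lin_formsM p A B :
  (p \mPo lin_forms A) \mPo lin_forms B = p \mPo lin_forms (A *m B).
Proof.
elim/mpoly_var_ind: p => [|c p q IHp IHq|i p IHp]; first by rewrite !rmorph1.
  by rewrite !compP IHp IHq.
rewrite !comp_mpolyM IHp.
suff -> : ('X_i \mPo lin_forms A) \mPo lin_forms B =
  'X_i \mPo lin_forms (A *m B) by [].
rewrite !comp_lin_formsX raddf_sum /=.
under eq_bigr do rewrite linearZ /= comp_lin_formsX scaler_sumr.
rewrite exchange_big /=; apply: eq_bigr => l _.
by rewrite mxE scaler_suml; apply: eq_bigr => j _; rewrite scalerA.
Qed.

Lemma comp_lin_forms1 p : p \mPo lin_forms 1%:M = p.
Proof.
rewrite -[RHS]comp_mpoly_id; congr (p \mPo _).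
apply: eq_from_tnth => i; rewrite tnth_lin_forms tnth_mktuple.
rewrite (bigD1 i) //= mxE eqxx scale1r big1 ?addr0 // => j /negPf ne_ji.
by rewrite mxE eq_sym ne_ji scale0r.
Qed.

Lemma comp_lin_formsK A p : A \in unitmx ->
  (p \mPo lin_forms A) \mPo lin_forms (invmx A) = p.
Proof. by move=> uA; rewrite comp_lin_formsM mulmxV ?comp_lin_forms1. Qed.

Lemma comp_lin_formsVK A p : A \in unitmx ->
  (p \mPo lin_forms (invmx A)) \mPo lin_forms A = p.
Proof. by move=> uA; rewrite comp_lin_formsM mulVmx ?comp_lin_forms1. Qed.

Lemma meval_comp_lin_forms A p (v : 'I_n -> k) :
  (p \mPo lin_forms A).@[v] = p.@[fun i => \sum_j A i j * v j].
Proof.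
rewrite comp_mpoly_meval; apply: meval_eq => i; rewrite tnth_lin_forms.
by rewrite raddf_sum; apply: eq_bigr => j _; rewrite /= mevalZ mevalXU.
Qed.

Lemma dhomog_prodn (I : finType) (d : I -> nat) (F : I -> {mpoly k[n]}) :
  (forall i, F i \is (d i).-homog) -> \prod_i F i \is (\sum_i d i)%N.-homog.
Proof.
move=> homF; apply: (big_ind2 (fun p e => p \is e.-homog)) => //.
  exact: dhomog1.
by move=> p1 e1 p2 e2; apply: dhomogM.
Qed.

Lemma dhomog_lin_forms A i : tnth (lin_forms A) i \is 1.-homog.
Proof.
rewrite tnth_lin_forms; apply: rpred_sum => j _.
by apply: dhomogZ; rewrite dhomogX /= mdeg1.
Qed.

Lemma dhomog_comp_lin_forms d p A :
  p \is d.-homog -> p \mPo lin_forms A \is d.-homog.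
Proof.
move=> /dhomogP homp; rewrite comp_mpolyEX big_seq.
apply: rpred_sum => m /homp <-; apply: dhomogZ; rewrite comp_mpolyX /= mdegE.
apply: dhomog_prodn => i; rewrite -[X in X.-homog]mul1n.
exact/dhomogMn/dhomog_lin_forms.
Qed.

Lemma mderivXU i j : ('X_j : {mpoly k[n]})^`M(i) = (j == i)%:R%:MP.
Proof.
rewrite mderivX mnm1E; case: eqP => [->|_]; last by rewrite scale0r mpolyC0.
by rewrite scale1r -{1}(add0m U_(i)%MM) addmK mpolyX0.
Qed.

Lemma mderiv_comp_lin_forms i A p :
  (p \mPo lin_forms A)^`M(i) = \sum_j A j i *: (p^`M(j) \mPo lin_forms A).
Proof.
elim/mpoly_var_ind: p => [|c p q IHp IHq|l p IHp].
- rewrite rmorph1 -mpolyC1 mderivC big1 // => j _.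
  by rewrite mderivC rmorph0 scaler0.
- rewrite compP mderivD mderivZ IHp IHq scaler_sumr -big_split /=.
  apply: eq_bigr => j _.
  by rewrite mderivD mderivZ compP scalerDr !scalerA mulrC.
rewrite comp_mpolyM mderivM IHp comp_lin_formsX.
have -> : (\sum_j A l j *: 'X_j)^`M(i) = (A l i)%:MP :> {mpoly k[n]}.
  rewrite raddf_sum (bigD1 i) //= big1 ?addr0 => [|j /negPf ne_ji].
    by rewrite mderivZ mderivXU eqxx -mul_mpolyC mulr1.
  by rewrite mderivZ mderivXU ne_ji scaler0.
under [RHS]eq_bigr do rewrite mderivM comp_mpolyD !comp_mpolyM scalerDr.
rewrite big_split /=; congr (_ + _); last first.
  rewrite mulr_sumr; apply: eq_bigr => j _.
  by rewrite comp_lin_formsX scalerAr.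
rewrite (bigD1 l) //= big1 ?addr0 => [|j /negPf ne_jl].
  by rewrite mderivXU eqxx comp_mpolyC mul1r -mul_mpolyC.
by rewrite mderivXU eq_sym ne_jl comp_mpolyC mul0r scaler0.
Qed.
End LinearSubstitution.

(** * Apolarity and catalecticant matrices *)

Section Catalecticant.
Variables (k : fieldType) (n : nat).
Implicit Types (p q f : {mpoly k[n]}) (A B : 'M[k]_n) (m : 'X_{1..n}).

(* [p(d/dX) f] evaluated at the origin. *)
Definition apolar p f : k :=
  \sum_(m <- msupp f) f@_m * (p@_m *+ \prod_(i < n) (m i)`!).

Lemma apolarP f c p q : apolar (c *: p + q) f = c * apolar p f + apolar q f.
Proof.
rewrite mulr_sumr -big_split /=; apply: eq_bigr => m _.
by rewrite mcoeffD mcoeffZ mulrnDl mulrDr -mulrnAr mulrCA.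
Qed.

Lemma apolarX m f : apolar 'X_[m] f = f@_m *+ \prod_(i < n) (m i)`!.
Proof.
rewrite /apolar; have [m_f|m_f] := boolP (m \in msupp f); last first.
  rewrite (memN_msupp_eq0 m_f) mul0rn big1_seq // => m' /andP[_ m'_f].
  rewrite mcoeffX; case: eqP => [mE|_]; last by rewrite mul0rn mulr0.
  by rewrite mE m'_f in m_f.
rewrite (bigD1_seq m) //= mcoeffX eqxx mulr1n.
rewrite [X in _ + X]big1 ?addr0 ?mulr_natr // => m' ne_m'.
by rewrite mcoeffX eq_sym (negPf ne_m') mul0rn mulr0.
Qed.

Lemma apolarX_mderivm m f : apolar 'X_[m] f = (f^`M[m])@_0.
Proof.
rewrite apolarX mcoeff_mderivm addm0; congr (_ *+ _).
by apply: eq_bigr => i _; rewrite ffactnn.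
Qed.

Lemma apolar_sum f (I : Type) (r : seq I) (c : I -> k) (F : I -> {mpoly k[n]}) :
  apolar (\sum_(i <- r) c i *: F i) f = \sum_(i <- r) c i * apolar (F i) f.
Proof.
elim: r => [|i r IHr]; last by rewrite !big_cons apolarP IHr.
by rewrite !big_nil /apolar big1 // => m _; rewrite mcoeff0 mul0rn mulr0.
Qed.

Lemma apolarPr p c f g : apolar p (c *: f + g) = c * apolar p f + apolar p g.
Proof.
rewrite (mpolyE p) !apolar_sum mulr_sumr -big_split /=; apply: eq_bigr => m _.
by rewrite !apolarX mcoeffD mcoeffZ mulrnDl mulrDr -mulrnAr mulrCA.
Qed.

Lemma apolarC p f : apolar p f = apolar f p.
Proof.
rewrite (mpolyE p) apolar_sum -mpolyE.
by apply: eq_bigr => m _; rewrite apolarX.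
Qed.

Lemma apolar_sumr p (I : Type) (r : seq I) (c : I -> k) (F : I -> {mpoly k[n]}) :
  apolar p (\sum_(i <- r) c i *: F i) = \sum_(i <- r) c i * apolar p (F i).
Proof.
elim: r => [|i r IHr]; last by rewrite !big_cons apolarPr IHr.
by rewrite !big_nil /apolar msupp0 big_nil.
Qed.

Lemma apolarXl i p f : apolar ('X_i * p) f = apolar p (f^`M(i)).
Proof.
rewrite (mpolyE p) mulr_sumr apolar_sum.
under eq_bigr do rewrite -scalerAr.
rewrite apolar_sum; apply: eq_bigr => m _; congr (_ * _).
by rewrite -mpolyXD !apolarX_mderivm mderivmDm mderivmU1m.
Qed.

(** Multiplication by ['X_i] is adjoint to the derivative in ['X_i], and the chain rule brings in
    the rows of [A^T]. For [p = 1] the pairing is evaluation at the origin, which linear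
    substitutions fix. *)
Lemma apolar_comp_lin_forms A p f :
  apolar p (f \mPo lin_forms A) = apolar (p \mPo lin_forms A^T) f.
Proof.
elim/mpoly_var_ind: p f => [|c p q IHp IHq|i p IHp] f.
- have apolar1 g : apolar 1 g = g.@[fun=> 0].
    rewrite -mpolyX0 apolarX_mderivm mderivm0m.
    elim/mpoly_var_ind: g => [|c p q IHp IHq|i p _].
    - by rewrite meval1 mcoeff1 eqxx.
    - by rewrite mcoeffD mcoeffZ mevalD mevalZ IHp IHq.
    - by rewrite mevalM mevalXU mul0r rmorphM /= mcoeffX mnm1_eq0 mul0r.
  rewrite rmorph1 !apolar1 meval_comp_lin_forms; apply: meval_eq => i.
  by rewrite big1 // => j _; rewrite mulr0.
- by rewrite apolarP IHp IHq comp_mpolyD comp_mpolyZ apolarP.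
rewrite apolarXl mderiv_comp_lin_forms apolar_sumr.
rewrite comp_mpolyM comp_lin_formsX mulr_suml.
under [in RHS]eq_bigr do rewrite -scalerAl mxE.
rewrite apolar_sum; apply: eq_bigr => j _.
by rewrite IHp apolarXl.
Qed.

Section Degree.
Variable d : nat.

(** Bounded multinomials form a finite type, so the monomials of degree [d] can index matrices. *)
Definition form_monom := {m : 'X_{1..n < d.+1} | mdeg m == d}.

Definition monom (i : 'I_#|{: form_monom}|) : 'X_{1..n} :=
  val (val (enum_val i)).

Lemma mdeg_monom i : mdeg (monom i) = d.
Proof. exact/eqP/(valP (enum_val i)). Qed.

Lemma monom_inj : injective monom.
Proof. by move=> i j /val_inj/val_inj/enum_val_inj. Qed.

Lemma monom_surj m : mdeg m = d -> exists i, monom i = m.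
Proof.
move=> dm; have lt_m : (mdeg m < d.+1)%N by rewrite dm.
have dm' : mdeg (BMultinom lt_m) == d by rewrite /= dm.
exists (enum_rank (Sub (BMultinom lt_m) dm' : form_monom)).
by rewrite /monom enum_rankK.
Qed.

Lemma dhomog_monomE p : p \is d.-homog ->
  p = \sum_i p@_(monom i) *: 'X_[monom i].
Proof.
move=> homp; apply/mpolyP => m; rewrite raddf_sum /=.
have [/monom_surj[j <-]|ne_d] := eqVneq (mdeg m) d.
  rewrite (bigD1 j) //= mcoeffZ mcoeffX eqxx mulr1 big1 ?addr0 // => i ne_ij.
  by rewrite mcoeffZ mcoeffX (inj_eq monom_inj) (negPf ne_ij) mulr0.
rewrite (dhomog_nemf_coeff homp ne_d) big1 // => i _.
rewrite mcoeffZ mcoeffX; case: eqP => [mE|]; last by rewrite mulr0.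
by rewrite -mE mdeg_monom eqxx in ne_d.
Qed.

(** The [d]-th symmetric power of [A] in the monomial basis. *)
Definition sym_power_mx A :=
  \matrix_(i, j) ('X_[monom i] \mPo lin_forms A)@_(monom j).

Lemma comp_monomE A i :
  'X_[monom i] \mPo lin_forms A = \sum_j sym_power_mx A i j *: 'X_[monom j].
Proof.
have hom : 'X_[monom i] \mPo lin_forms A \is d.-homog.
  by apply: dhomog_comp_lin_forms; rewrite dhomogX /= mdeg_monom.
rewrite {1}(dhomog_monomE hom); apply: eq_bigr => j _; by rewrite mxE.
Qed.

Lemma sym_power_mxM A B :
  sym_power_mx (A *m B) = sym_power_mx A *m sym_power_mx B.
Proof.
apply/matrixP => i j; rewrite mxE -comp_lin_formsM comp_monomE [RHS]mxE.
rewrite comp_mpoly_sum raddf_sum; apply: eq_bigr => l _ /=.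
by rewrite comp_mpolyZ mcoeffZ !mxE.
Qed.

Lemma sym_power_mx1 : sym_power_mx 1%:M = 1%:M.
Proof.
apply/matrixP => i j.
by rewrite !mxE comp_lin_forms1 mcoeffX (inj_eq monom_inj).
Qed.

(** The Gram matrix of the bilinear form [apolar (p * q) f] on the monomials of degree [d]; hence
    substitutions act on it by congruence. *)
Definition catalecticant f :=
  \matrix_(i < #|{: form_monom}|, j < #|{: form_monom}|)
     (f^`M[monom i + monom j])@_0.

Lemma catalecticant_comp A f :
  catalecticant (f \mPo lin_forms A) =
    sym_power_mx A^T *m catalecticant f *m (sym_power_mx A^T)^T.
Proof.
apply/matrixP => i j; rewrite mxE -apolarX_mderivm apolar_comp_lin_forms mpolyXD.
rewrite comp_mpolyM !comp_monomE mulr_suml.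
under eq_bigr do rewrite -scalerAl.
rewrite apolar_sum -mulmxA mxE; apply: eq_bigr => a _; congr (_ * _).
rewrite mulr_sumr; under eq_bigr do rewrite -scalerAr.
rewrite apolar_sum mxE; apply: eq_bigr => b _.
by rewrite -mpolyXD apolarX_mderivm !mxE mulrC.
Qed.

Lemma catalecticantZ c f : catalecticant (c *: f) = c *: catalecticant f.
Proof. by apply/matrixP => i j; rewrite !mxE mderivmZ mcoeffZ. Qed.
End Degree.
End Catalecticant.

(** * Multiplicative functions on 3 x 3 matrices *)

Lemma lup_decomposition (k : fieldType) n (A : 'M[k]_n.+1) :
  exists (s : 'S_n.+1) (L U : 'M[k]_n.+1),
    [/\ perm_mx s *m A = L *m U,
        forall i j : 'I_n.+1, (i <= j)%N -> L i j = (i == j)%:R &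
        forall i j : 'I_n.+1, (j < i)%N -> U i j = 0].
Proof.
have := cormen_lup_correct A; have := cormen_lup_perm A.
have := @cormen_lup_lower _ _ A; have := @cormen_lup_upper _ _ A.
by case: (cormen_lup A) => [[P L] U] /= Uu Ll /is_perm_mxP[s ->] PA; exists s, L, U.
Qed.

Section ThreeByThree.
Variable k : fieldType.
Implicit Types A B : 'M[k]_3.

Definition mx3 (a00 a01 a02 a10 a11 a12 a20 a21 a22 : k) : 'M[k]_3 :=
  \matrix_(i, j) nth 0 (nth [::]
    [:: [:: a00; a01; a02]; [:: a10; a11; a12]; [:: a20; a21; a22]] i) j.

Definition i0 : 'I_3 := @Ordinal 3 0 isT.
Definition i1 : 'I_3 := @Ordinal 3 1 isT.
Definition i2 : 'I_3 := @Ordinal 3 2 isT.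

Lemma ord3P (P : 'I_3 -> Prop) : P i0 -> P i1 -> P i2 -> forall i, P i.
Proof.
move=> P0 P1 P2 [[|[|[|//]]] lt_i]; [move: P0|move: P1|move: P2];
  by congr P; apply: val_inj.
Qed.

Lemma sum_ord3 (V : nmodType) (F : 'I_3 -> V) : \sum_i F i = F i0 + F i1 + F i2.
Proof.
rewrite !big_ord_recl big_ord0 addr0 addrA.
by congr (F _ + F _ + F _); apply: val_inj.
Qed.

Lemma prod_ord3 (R : pzSemiRingType) (F : 'I_3 -> R) :
  \prod_i F i = F i0 * F i1 * F i2.
Proof.
rewrite !big_ord_recl big_ord0 mulr1 mulrA.
by congr (F _ * F _ * F _); apply: val_inj.
Qed.

Lemma mx3E A : A = mx3 (A i0 i0) (A i0 i1) (A i0 i2) (A i1 i0) (A i1 i1) (A i1 i2)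
                       (A i2 i0) (A i2 i1) (A i2 i2).
Proof. by apply/matrixP; apply: ord3P; apply: ord3P; rewrite mxE. Qed.

Lemma mul_mx3 a00 a01 a02 a10 a11 a12 a20 a21 a22
              b00 b01 b02 b10 b11 b12 b20 b21 b22 :
  mx3 a00 a01 a02 a10 a11 a12 a20 a21 a22 *m mx3 b00 b01 b02 b10 b11 b12 b20 b21 b22 =
  mx3 (a00 * b00 + a01 * b10 + a02 * b20)
      (a00 * b01 + a01 * b11 + a02 * b21)
      (a00 * b02 + a01 * b12 + a02 * b22)
      (a10 * b00 + a11 * b10 + a12 * b20)
      (a10 * b01 + a11 * b11 + a12 * b21)
      (a10 * b02 + a11 * b12 + a12 * b22)
      (a20 * b00 + a21 * b10 + a22 * b20)
      (a20 * b01 + a21 * b11 + a22 * b21)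
      (a20 * b02 + a21 * b12 + a22 * b22).
Proof.
by apply/matrixP; apply: ord3P; apply: ord3P; rewrite mxE sum_ord3 !mxE.
Qed.

Lemma det_mx3 a00 a01 a02 a10 a11 a12 a20 a21 a22 :
  \det (mx3 a00 a01 a02 a10 a11 a12 a20 a21 a22) =
    a00 * (a11 * a22 - a12 * a21) - a01 * (a10 * a22 - a12 * a20)
      + a02 * (a10 * a21 - a11 * a20).
Proof.
rewrite (expand_det_row _ ord0) !big_ord_recl big_ord0 /cofactor.
rewrite !(expand_det_row _ ord0) !big_ord_recl !big_ord0 /cofactor !det_mx11 !mxE /=.
rewrite /bump /=; ring.
Qed.

Lemma mx3_1 : mx3 1 0 0 0 1 0 0 0 1 = 1%:M.
Proof. by apply/matrixP; apply: ord3P; apply: ord3P; rewrite !mxE. Qed.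

Section MultiplicativeFunction.
Variable chi : 'M[k]_3 -> k.
Hypotheses (chi1 : chi 1%:M = 1) (chiM : {morph chi : A B / A *m B >-> A * B}).

Let chi_neq0 A B : A *m B = 1%:M -> chi A != 0.
Proof.
move=> AB1; apply: contra_eq_neq chi1 => chiA.
by rewrite -AB1 chiM chiA mul0r eq_sym oner_eq0.
Qed.

(** [T] is the commutator of [A] and [B], written without inverses; the values of [chi] commute and
    are nonzero on invertible matrices. *)
Let chi_comm T A B A' B' : A *m A' = 1%:M -> B *m B' = 1%:M ->
  T *m (B *m A) = A *m B -> chi T = 1.
Proof.
move=> AA' BB' /(congr1 chi); rewrite !chiM [chi A * _]mulrC => /eqP.
rewrite -{2}[chi B * chi A]mul1r => /eqP /mulIf -> //.
by rewrite mulf_neq0 ?(chi_neq0 AA') ?(chi_neq0 BB').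
Qed.

Ltac mx3_ring := rewrite ?mul_mx3 -?mx3_1; congr mx3; ring.

(* Elementary matrices are commutators, whence [chi = 1] on them. *)
Lemma chi_lower a b c : chi (mx3 1 0 0 a 1 0 b c 1) = 1.
Proof.
have -> : mx3 1 0 0 a 1 0 b c 1 =
  mx3 1 0 0 a 1 0 0 0 1 *m (mx3 1 0 0 0 1 0 b 0 1 *m mx3 1 0 0 0 1 0 0 c 1).
  by mx3_ring.
rewrite !chiM.
(* With E_ij(a) = 1 + a e_ij and l the third index, E_ij(a) is the commutator of E_il(a) and
   E_lj(1). *)
rewrite (@chi_comm _ (mx3 1 0 0 0 1 a 0 0 1) (mx3 1 0 0 0 1 0 1 0 1)
                     (mx3 1 0 0 0 1 (- a) 0 0 1) (mx3 1 0 0 0 1 0 (- 1) 0 1));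
  try by mx3_ring.
rewrite (@chi_comm _ (mx3 1 0 0 0 1 0 0 b 1) (mx3 1 0 0 1 1 0 0 0 1)
                     (mx3 1 0 0 0 1 0 0 (- b) 1) (mx3 1 0 0 (- 1) 1 0 0 0 1));
  try by mx3_ring.
rewrite (@chi_comm _ (mx3 1 0 0 0 1 0 c 0 1) (mx3 1 1 0 0 1 0 0 0 1)
                     (mx3 1 0 0 0 1 0 (- c) 0 1) (mx3 1 (- 1) 0 0 1 0 0 0 1));
  try by mx3_ring.
by rewrite !mul1r.
Qed.

(** Conjugation by the order-reversing permutation exchanges upper and lower unitriangular
    matrices. *)
Lemma chi_upper a b c : chi (mx3 1 a b 0 1 c 0 0 1) = 1.
Proof.
pose W := mx3 0 0 1 0 1 0 1 0 0.
have WW : W *m W = 1%:M by mx3_ring.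
have E : mx3 1 a b 0 1 c 0 0 1 *m W = W *m mx3 1 0 0 c 1 0 b a 1 by mx3_ring.
have := congr1 chi E; rewrite !chiM chi_lower mulr1 => /eqP.
by rewrite -{2}[chi W]mul1r => /eqP /mulIf -> //; apply: chi_neq0 WW.
Qed.

Let delta a := chi (mx3 a 0 0 0 1 0 0 0 1).

Let deltaM a b : delta (a * b) = delta a * delta b.
Proof. by rewrite /delta -chiM; congr chi; mx3_ring. Qed.

(** Conjugation by transpositions brings each diagonal entry to the first place. *)
Let chi_diag a b c : chi (mx3 a 0 0 0 b 0 0 0 c) = delta (a * b * c).
Proof.
have swap D E W : W *m W = 1%:M -> E *m W = W *m D -> chi E = chi D.
  move=> WW /(congr1 chi); rewrite !chiM mulrC => /mulfI; apply; exact: chi_neq0 WW.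
have -> : mx3 a 0 0 0 b 0 0 0 c =
  mx3 a 0 0 0 1 0 0 0 1 *m (mx3 1 0 0 0 b 0 0 0 1 *m mx3 1 0 0 0 1 0 0 0 c).
  by mx3_ring.
rewrite !chiM !deltaM mulrA; congr (_ * _ * _).
  by apply: (swap _ _ (mx3 0 1 0 1 0 0 0 0 1)); mx3_ring.
by apply: (swap _ _ (mx3 0 0 1 0 1 0 1 0 0)); mx3_ring.
Qed.

(* In [P A = L U] only the permutation matrix [P] and the sign of its
   determinant survive; the exponent 6 is the order of 'S_3. *)
Lemma chi_det1 A : \det A = 1 -> chi A ^+ 6 = 1.
Proof.
move=> detA.
have [s [L [U [PA Ll Uu]]]] := lup_decomposition A.
have EL : L = mx3 1 0 0 (L i1 i0) 1 0 (L i2 i0) (L i2 i1) 1.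
  rewrite {1}(mx3E L) (Ll i0 i0) // (Ll i0 i1) // (Ll i0 i2) // (Ll i1 i1) //.
  by rewrite (Ll i1 i2) // (Ll i2 i2).
have chiL : chi L = 1 by rewrite EL chi_lower.
have detU : \det U = (-1) ^+ s.
  have detL : \det L = 1 by rewrite EL det_mx3; ring.
  by have := congr1 determinant PA; rewrite !det_mulmx detL detA det_perm mulr1 mul1r.
(* [U] is unitriangular times a diagonal matrix whose determinant is a sign, so [chi U] squares to
   [delta 1 = 1]. *)
have chiU2 : chi U ^+ 2 = 1.
  have EU : U = mx3 (U i0 i0) (U i0 i1) (U i0 i2) 0 (U i1 i1) (U i1 i2) 0 0 (U i2 i2).
    by rewrite {1}(mx3E U) (Uu i1 i0) // (Uu i2 i0) // (Uu i2 i1).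
  have detE : U i0 i0 * U i1 i1 * U i2 i2 = (-1) ^+ s.
    by rewrite -detU [in RHS]EU det_mx3; ring.
  have : U i0 i0 * U i1 i1 * U i2 i2 != 0 by rewrite detE signr_eq0.
  rewrite !mulf_eq0 !negb_or -andbA => /and3P[U0 U1 U2].
  have -> : U =
      mx3 1 (U i0 i1 / U i1 i1) (U i0 i2 / U i2 i2) 0 1 (U i1 i2 / U i2 i2) 0 0 1
                *m mx3 (U i0 i0) 0 0 0 (U i1 i1) 0 0 0 (U i2 i2).
    by rewrite [LHS]EU mul_mx3 !mulfVK //; congr mx3; ring.
  rewrite chiM chi_upper chi_diag detE mul1r expr2 -deltaM -expr2 sqrr_sign.
  by rewrite /delta mx3_1.
have chiP6 : chi (perm_mx s) ^+ 6 = 1.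
  have chiX e : chi (perm_mx (s ^+ e)%g) = chi (perm_mx s) ^+ e.
    elim: e => [|e IHe]; first by rewrite expg0 perm_mx1.
    by rewrite expgS perm_mxM chiM IHe exprS.
  rewrite -chiX (_ : (s ^+ 6 = 1)%g) ?perm_mx1 //.
  have /dvdnP[e ->] : (#[s]%g %| 6)%N.
    by rewrite -[6%N]/(3`!)%N -card_Sn -cardsT cardSg ?subsetT.
  by rewrite mulnC expgM expg_order expg1n.
have := congr1 chi PA; rewrite !chiM chiL mul1r.
move/(congr1 (fun x => x ^+ 6)); rewrite exprMn chiP6 mul1r => ->.
by rewrite (exprM _ 2 3) chiU2 expr1n.
Qed.
End MultiplicativeFunction.
End ThreeByThree.

(** * The catalecticant of a power of a sum of squares *)

(* [hermite a j] is the coefficient of the Hermite polynomial [He_j] in [X^a];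
   in particular [hermite a 0] is the a-th moment of the standard Gaussian. *)
Fixpoint hermite (a j : nat) : nat :=
  if a is a'.+1 then
    ((if j is j'.+1 then hermite a' j' else 0) + j.+1 * hermite a' j.+1)%N
  else (j == 0)%N.

Lemma hermite_gt a j : (a < j)%N -> hermite a j = 0%N.
Proof.
elim: a j => [|a IHa] [|j] //= lt_aj.
by rewrite !IHa ?muln0 //; lia.
Qed.

Lemma hermite_diag a : hermite a a = 1%N.
Proof. by elim: a => //= a ->; rewrite hermite_gt ?muln0. Qed.

(** Both sides are the coefficient of He_j in the derivative of X^(a+1), as He_(j+1)' = (j+1)
    He_j. *)
Lemma hermite_deriv a j : (j.+1 * hermite a.+1 j.+1 = a.+1 * hermite a j)%N.
Proof.
elim: a j => [|a IHa] j; first by case: j => [|j] /=; rewrite ?muln0.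
have E2 := IHa j.+1.
have -> : hermite a.+2 j.+1 = (hermite a.+1 j + j.+2 * hermite a.+1 j.+2)%N by [].
rewrite E2; case: j {E2} => [|j].
  by rewrite [hermite a.+1 0]/=; lia.
have E1 := IHa j.
have : hermite a.+1 j.+1 = (hermite a j + j.+2 * hermite a j.+2)%N by [].
move: (hermite a.+1 j.+1) (hermite a j) (hermite a j.+2) E1 => h p q E1 Eh.
nia.
Qed.

(** The recurrence E(X^(a+2)) = (a+1) E(X^a), to be matched with the differentiation of powers of
    [sumsq]. *)
Lemma hermite_moment a : hermite a.+2 0 = (a.+1 * hermite a 0)%N.
Proof. by have := hermite_deriv a 0; rewrite mul1n => <- /=; rewrite add0n mul1n. Qed.

(* [E(X^a X^b)] in terms of the orthogonal basis [He_j], with [E(He_j^2) = j!]. *)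
Lemma hermite_add M a b : (a + b <= M)%N ->
  (\sum_(j < M.+1) j`! * (hermite a j * hermite b j) = hermite (a + b) 0)%N.
Proof.
pose S a b := (\sum_(j < M.+1) j`! * (hermite a j * hermite b j))%N.
pose T a b := (\sum_(j < M) (j.+1)`! * (hermite a j * hermite b j.+1
                                     + hermite a j.+1 * hermite b j))%N.
have SC x y : S x y = S y x.
  by apply: eq_bigr => j _; rewrite [(hermite x j * _)%N]mulnC.
have TC x y : T x y = T y x.
  apply: eq_bigr => j _; rewrite addnC [(hermite x j.+1 * _)%N]mulnC.
  by rewrite [(hermite x j * _)%N]mulnC.
(* A shift of the index turns the sum into the symmetric expression [T]; the top term vanishes
   because [x <= M]. *)
have ST x y : (x <= M)%N -> S x.+1 y = T x y.
  move=> xM; rewrite /S.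
  under eq_bigr do rewrite /= mulnDl mulnDr.
  rewrite big_split /= big_ord_recl mul0n muln0 add0n.
  rewrite [X in (_ + X)%N]big_ord_recr /= hermite_gt // muln0 mul0n muln0 addn0.
  rewrite -big_split; apply: eq_bigr => j _ /=.
  rewrite /bump /= add1n mulnDr; congr (_ + _)%N.
  by rewrite factS; lia.
(* Multiplication by X is self-adjoint, so factors move from [a] to [b] until [a = 0], where only
   [j = 0] contributes. *)
have SS x y : (x <= M)%N -> (y <= M)%N -> S x.+1 y = S x y.+1.
  by move=> xM yM; rewrite ST // TC -ST // SC.
elim: a b => [|a IHa] b abM.
  rewrite big_ord_recl big1 /= ?addn0 ?mul1n ?add0n // => j _.
  by rewrite /= mul0n muln0.
by rewrite -[LHS]/(S a.+1 b) SS ?[S _ _]IHa ?addSnnS //; lia.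
Qed.
Arguments hermite : simpl never.

Lemma lem_mdeg_eq n (m m' : 'X_{1..n}) :
  (m <= m')%MM -> mdeg m = mdeg m' -> m = m'.
Proof.
move=> /submK <-; rewrite mdegD => /esym/eqP.
by rewrite -{2}(add0n (mdeg m)) eqn_add2r mdeg_eq0 => /eqP->; rewrite add0m.
Qed.

Lemma mdegS_ex n (m : 'X_{1..n}) e : mdeg m = e.+1 -> exists i, m i != 0%N.
Proof.
move=> dm; apply/existsP; apply: contraPT dm; rewrite negb_exists => /forallP m0.
rewrite (_ : m = 0%MM) ?mdeg0 //; apply/mnmP => i; rewrite mnm0E.
by apply/eqP; rewrite -[_ == _]negbK.
Qed.

Lemma leq_mdeg n (m : 'X_{1..n}) i : (m i <= mdeg m)%N.
Proof. by rewrite mdegE (bigD1 i) //= leq_addr. Qed.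

Section GaussianGram.
Variables n d : nat.

(** Gaussian moments of products of two monomials, kept in [nat] so that the matrix can be read both
    in [rat] and in [k]. *)
Definition gauss_gram : 'M[nat]_#|{: form_monom n d}| :=
  \matrix_(i, j) (\prod_(l < n) hermite (monom i l + monom j l) 0)%N.

(** The coefficient of the product of the He_(e l) in a monomial. The bound [d + d] is the one
    [hermite_add] asks for. *)
Let hermite_monom (i : 'I_#|{: form_monom n d}|)
    (e : {ffun 'I_n -> 'I_(d + d).+1}) : nat :=
  (\prod_(l < n) hermite (monom i l) (e l))%N.

Let gauss_gramE i j : gauss_gram i j =
  (\sum_(e : {ffun 'I_n -> 'I_(d + d).+1})
     \prod_(l < n) (e l)`! * (hermite_monom i e * hermite_monom j e))%N.
Proof.
rewrite mxE.
transitivity (\prod_(l < n) \sum_(q < (d + d).+1)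
    q`! * (hermite (monom i l) q * hermite (monom j l) q))%N.
  apply: eq_bigr => l _; rewrite hermite_add //.
  by rewrite leq_add // (leq_trans (leq_mdeg _ _)) // mdeg_monom.
rewrite bigA_distr_bigA; apply: eq_bigr => e _.
by rewrite !big_split.
Qed.

(* The quadratic form of the Gram matrix is a sum of squares, and among forms of
   degree d the squares indexed by monomials of degree d are those of the
   coefficients. *)
Lemma gauss_gram_nondegenerate (v : 'rV[rat]_#|{: form_monom n d}|) :
  v *m map_mx (fun a : nat => a%:R) gauss_gram = 0 -> v = 0.
Proof.
move=> vG0.
pose Lv e := \sum_i v 0 i * (hermite_monom i e)%:R.
have sum0 : \sum_(e : {ffun 'I_n -> 'I_(d + d).+1})
    (\prod_(l < n) (e l)`!)%:R * Lv e ^+ 2 = 0.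
  transitivity ((v *m map_mx (fun a : nat => a%:R) gauss_gram *m v^T) 0 0); last first.
    by rewrite vG0 mul0mx mxE.
  transitivity (\sum_i \sum_j v 0 i * (gauss_gram i j)%:R * v 0 j); last first.
    rewrite exchange_big mxE; apply: eq_bigr => j _ /=.
    by rewrite !mxE mulr_suml; apply: eq_bigr => i _; rewrite !mxE.
  under eq_bigr do rewrite /Lv expr2 big_distrlr mulr_sumr.
  rewrite exchange_big; apply: eq_bigr => i _ /=.
  under eq_bigr do rewrite mulr_sumr.
  rewrite exchange_big; apply: eq_bigr => j _ /=.
  rewrite gauss_gramE natr_sum mulr_sumr mulr_suml; apply: eq_bigr => e _.
  by rewrite !natrM; ring.
have Lv0 e : Lv e = 0.
  have w_gt0 (e' : {ffun 'I_n -> 'I_(d + d).+1}) :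
      0 < (\prod_(l < n) (e' l)`!)%:R :> rat.
    by rewrite ltr0n prodn_gt0 // => l; rewrite fact_gt0.
  have := psumr_eq0P _ sum0 (i := e) isT.
  move=> H; apply/eqP; rewrite -sqrf_eq0; apply/eqP.
  apply: (mulfI (lt0r_neq0 (w_gt0 e))); rewrite mulr0; apply: H => e' _.
  by rewrite mulr_ge0 ?sqr_ge0 // ltW.
apply/rowP => i; rewrite mxE.
have lt_mon l : (monom i l < (d + d).+1)%N.
  by rewrite ltnS (leq_trans (leq_mdeg _ _)) // mdeg_monom leq_addr.
have := Lv0 [ffun l => Ordinal (lt_mon l)].
rewrite /Lv (bigD1 i) //= big1 => [|j ne_ji].
  rewrite addr0 /hermite_monom big1 ?mulr1 // => l _.
  by rewrite ffunE hermite_diag.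
suff -> : hermite_monom j [ffun l => Ordinal (lt_mon l)] = 0%N by rewrite mulr0.
have /forallPn[l]: ~~ [forall l, monom i l <= monom j l]%N.
  apply: contra ne_ji => /forallP le_ij; apply/eqP/monom_inj/esym/lem_mdeg_eq.
    exact/mnm_lepP.
  by rewrite !mdeg_monom.
rewrite -ltnNge => lt_ji; rewrite /hermite_monom (bigD1 l) //= ffunE.
by rewrite hermite_gt ?mul0n.
Qed.
End GaussianGram.

Section PowersOfSumOfSquares.
Variables (k : fieldType) (n : nat).
Hypothesis char0 : [pchar k] =i pred0.

Definition sumsq : {mpoly k[n]} := \sum_(i < n) 'X_i ^+ 2.

Lemma mderivXn (p : {mpoly k[n]}) i e :
  (p ^+ e.+1)^`M(i) = e.+1%:R *: (p^`M(i) * p ^+ e).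
Proof.
elim: e => [|e IHe]; first by rewrite expr1 expr0 mulr1 scale1r.
rewrite exprS mderivM IHe -scalerAr mulrCA -exprS.
by rewrite -[X in X + _]scale1r -scalerDl nat1r.
Qed.

Lemma mderiv_sumsq i : sumsq^`M(i) = 2%:R *: 'X_i.
Proof.
rewrite /sumsq raddf_sum (bigD1 i) //= big1 ?addr0 => [|j /negPf ne_ji].
  by rewrite mderivXn mderivXU eqxx mul1r expr1.
by rewrite mderivXn mderivXU ne_ji mpolyC0 mul0r scaler0.
Qed.

Lemma apolarXX (m : 'X_{1..n}) i (g : {mpoly k[n]}) :
  apolar 'X_[m] ('X_i * g) = (m i)%:R * apolar 'X_[m - U_(i)] g.
Proof.
rewrite apolarC apolarXl mderivX -[_ *: _]addr0 apolarPr.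
by rewrite [X in _ + X]/apolar msupp0 big_nil addr0 apolarC.
Qed.

(** Moving one ['X_i] across the pairing differentiates the power of [sumsq], which yields a factor
    ['X_i]; moving that one back lowers the exponent a second time, as in the recurrence of Gaussian
    moments. *)
Lemma apolar_sumsq d (m : 'X_{1..n}) : mdeg m = (d + d)%N ->
  apolar 'X_[m] (sumsq ^+ d) = (2 ^ d * d`! * \prod_(l < n) hermite (m l) 0)%:R.
Proof.
elim: d m => [|d IHd] m.
  move=> /eqP; rewrite mdeg_eq0 => /eqP->; rewrite expr0 apolarX mcoeff1 eqxx.
  by rewrite !big1 // => l _; rewrite mnm0E.
move=> dm; have [i mi] := mdegS_ex dm.
have lei : (U_(i) <= m)%MM by rewrite lep1mP.
have Em := submK lei; set m' := (m - U_(i))%MM in Em.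
have dm' : mdeg m' = (d + d).+1.
  by move: dm; rewrite -Em mdegD mdeg1 addn1 addSn addnS => -[].
rewrite -{1}Em addmC mpolyXD apolarXl mderivXn mderiv_sumsq -scalerAl scalerA.
rewrite -[_ *: _]addr0 apolarPr [X in _ + X]/apolar msupp0 big_nil addr0 apolarXX.
have Emi : m i = (m' i).+1 by rewrite -Em mnmDE mnm1E eqxx addn1.
have Eml l : l != i -> m l = m' l.
  by move=> ne_li; rewrite -Em mnmDE mnm1E eq_sym (negPf ne_li) addn0.
(* If ['X_i] has exponent 1, both sides vanish, the first Gaussian moment being 0. *)
rewrite (bigD1 i) //= Emi; case E0 : (m' i) => [|a].
  by rewrite mul0r mulr0 [hermite _ _]/= mul0n muln0.
have lei' : (U_(i) <= m')%MM by rewrite lep1mP E0.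
have Em' := submK lei'; set m2 := (m' - U_(i))%MM in Em' *.
rewrite IHd; last by apply/eqP; rewrite -eqSS -dm' -Em' mdegD mdeg1 addn1.
rewrite (bigD1 i) //= hermite_moment.
have -> : m2 i = a by apply/eqP; rewrite -eqSS -E0 -Em' mnmDE mnm1E eqxx addn1.
rewrite [in RHS](eq_bigr (fun l => hermite (m2 l) 0)); last first.
  move=> l ne_li.
  by rewrite Eml // -Em' mnmDE mnm1E eq_sym (negPf ne_li) addn0.
rewrite -!natrM; congr _%:R; rewrite expnS factS; lia.
Qed.

Lemma intr_neq0 (z : int) : z != 0 -> z%:~R != 0 :> k.
Proof.
move/pcharf0P: char0 => natr_eq0.
by case: z => e nz_e; rewrite ?NegzE ?mulrNz ?oppr_eq0 natr_eq0.
Qed.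

(** Up to a nonzero factor this is the image of an integer. Positivity over [rat] shows the integer
    nonzero, and characteristic 0 carries this to [k]. *)
Lemma det_catalecticant_sumsq d : \det (catalecticant d (sumsq ^+ d)) != 0.
Proof.
have -> : catalecticant d (sumsq ^+ d) =
    (2 ^ d * d`!)%:R *: map_mx intr (map_mx Posz (gauss_gram n d)).
  apply/matrixP => i j; rewrite !mxE -apolarX_mderivm apolar_sumsq.
    rewrite natrM; congr (_ * _%:R); apply: eq_bigr => l _.
    by rewrite mnmDE.
  by rewrite mdegD !mdeg_monom.
rewrite detZ det_map_mx mulf_neq0 ?expf_neq0 //.
  move/pcharf0P: char0 => ->.
  by rewrite muln_eq0 negb_or expn_eq0 -lt0n fact_gt0.
apply: intr_neq0; apply/negP => det0.
have : \det (map_mx intr (map_mx Posz (gauss_gram n d))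
               : 'M[rat]_#|{: form_monom n d}|) == 0.
  by rewrite det_map_mx (eqP det0).
move=> /det0P[v /negP nz_v vG0]; apply/nz_v/eqP/gauss_gram_nondegenerate.
by rewrite -[RHS]vG0; congr (_ *m _); apply/matrixP => i j; rewrite !mxE.
Qed.
End PowersOfSumOfSquares.

(** * Zariski closures and the catalecticant invariant *)

Definition linear_polyfun (k : fieldType) (V : vectType k) (l : V -> k) :
    {mpoly k[\dim {:V}]} :=
  \sum_(i < \dim {:V}) l (vbasis {:V})`_i *: 'X_i.

Lemma linear_polyfunE (k : fieldType) (V : vectType k) (l : V -> k) :
    (forall c u v, l (c *: u + v) = c * l u + l v) ->
  forall v, polyfun_eval (linear_polyfun l) v = l v.
Proof.
move=> lP v; have l0 : l 0 = 0.
  by have := lP (-1) 0 0; rewrite scaler0 addr0 mulN1r addNr.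
rewrite /polyfun_eval /linear_polyfun raddf_sum {2}(coord_vbasis (memvf v)).
have -> (I : finType) (c : I -> k) (u : I -> V) :
    l (\sum_i c i *: u i) = \sum_i c i * l (u i).
  apply: (big_rec2 (fun x y => l x = y)) => // i y1 y2 _ <-; exact: lP.
by apply: eq_bigr => i _; rewrite /= mevalZ mevalXU mulrC.
Qed.

(** A polynomial function vanishing on [S] pulls back to a polynomial in [t] with all nonzero [t] as
    roots. It is zero because [k] is infinite, so it vanishes at [t = 0] too. *)
Lemma zariski_closure_curve (k : closedFieldType) (V : vectType k) (S : V -> Prop)
    N (g : 'I_N.+1 -> V) :
    (forall t : k, t != 0 -> S (\sum_(i < N.+1) t ^+ i *: g i)) ->
  zariski_closure S (g ord0).
Proof.
move=> Sg F F0.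
pose c j : {poly k} := \sum_(i < N.+1) coord (vbasis {:V}) j (g i) *: 'X^i.
have cE j t : (c j).[t] = coord (vbasis {:V}) j (\sum_(i < N.+1) t ^+ i *: g i).
  rewrite /c horner_sum linear_sum; apply: eq_bigr => i _.
  by rewrite hornerZ hornerXn linearZ /= mulrC.
pose p := mmap polyC c F.
have pE t : p.[t] = polyfun_eval F (\sum_(i < N.+1) t ^+ i *: g i).
  rewrite /p /mmap horner_sum /polyfun_eval mevalE; apply: eq_bigr => m _.
  rewrite hornerM hornerC /mmap1 horner_prod; congr (_ * _).
  by apply: eq_bigr => i _; rewrite horner_exp cE.
have p0 : p = 0.
  apply/eqP/negPn/negP => nz_p.
  (* The factor ['X] excludes [t = 0] as a non-root. *)
  have /closed_nonrootP[t]: p * 'X != 0 by rewrite mulf_neq0 ?polyX_eq0.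
  case/negP; rewrite rootE hornerM hornerX; have [->|nz_t] := eqVneq t 0.
    by rewrite mulr0.
  by rewrite pE F0 ?mul0r //; apply: Sg.
have := pE 0; rewrite p0 horner0 big_ord_recl expr0 scale1r big1 ?addr0 // => i _.
by rewrite exprS mul0r scale0r.
Qed.

Section Invariant.
Variables (k : fieldType) (n : nat).

Lemma det_catalecticant_comp (A : 'M[k]_3) f :
  \det (catalecticant n (f \mPo lin_forms A)) =
    \det (sym_power_mx n A^T) ^+ 2 * \det (catalecticant n f).
Proof. by rewrite catalecticant_comp !det_mulmx det_tr mulrAC -expr2. Qed.

Definition cat_invariant (f : {mpoly k[3]}) := \det (catalecticant n f) ^+ 6.

(** The determinant of the symmetric power is multiplicative, so [chi_det1] applies to it. *)
Lemma cat_invariant_SL3 (A : 'M[k]_3) f :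
  \det A = 1 -> cat_invariant (f \mPo lin_forms A) = cat_invariant f.
Proof.
move=> detA; rewrite /cat_invariant det_catalecticant_comp exprMn exprAC.
rewrite (@chi_det1 _ (fun B => \det (sym_power_mx n B))) ?expr1n ?mul1r ?det_tr //.
  by rewrite sym_power_mx1 det1.
by move=> B C; rewrite sym_power_mxM det_mulmx.
Qed.

(** The entries of the catalecticant are linear in [f]. *)
Lemma cat_invariant_polyfun d : exists F : {mpoly k[\dim {:ternary_form k d}]},
  forall f : ternary_form k d, polyfun_eval F f = cat_invariant f.
Proof.
pose N := #|{: form_monom 3 n}|.
pose entry (i j : 'I_N) (f : ternary_form k d) : k :=
  ((mpoly_of_dhomog f)^`M[monom i + monom j])@_0.
exists (\det (\matrix_(i < N, j < N) linear_polyfun (entry i j)) ^+ 6) => f.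
rewrite /polyfun_eval rmorphXn /= -det_map_mx; congr (\det _ ^+ 6).
apply/matrixP => i j; rewrite !mxE.
have := @linear_polyfunE k (ternary_form k d) (entry i j); apply => c u v.
by rewrite /entry (linearP (@mpoly_of_dhomog 3 k d)) mderivmD mderivmZ mcoeffD mcoeffZ.
Qed.
End Invariant.

(** * Curves in normal form *)

Section StandardConic.
Variable k : fieldType.
Implicit Types (p q : {mpoly k[3]}) (A B : 'M[k]_3).

Definition std_conic : {mpoly k[3]} := 'X_i0 * 'X_i2 - 'X_i1 ^+ 2.

Lemma comp_mx3 a00 a01 a02 a10 a11 a12 a20 a21 a22 :
  let L := lin_forms (mx3 a00 a01 a02 a10 a11 a12 a20 a21 a22 : 'M[k]_3) in
  [/\ 'X_i0 \mPo L = a00%:MP * 'X_i0 + a01%:MP * 'X_i1 + a02%:MP * 'X_i2,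
      'X_i1 \mPo L = a10%:MP * 'X_i0 + a11%:MP * 'X_i1 + a12%:MP * 'X_i2 &
      'X_i2 \mPo L = a20%:MP * 'X_i0 + a21%:MP * 'X_i1 + a22%:MP * 'X_i2].
Proof.
by split; rewrite comp_lin_formsX sum_ord3 !mxE /= !mul_mpolyC.
Qed.

Lemma comp_std_conic A :
  std_conic \mPo lin_forms A =
    ('X_i0 \mPo lin_forms A) * ('X_i2 \mPo lin_forms A) - ('X_i1 \mPo lin_forms A) ^+ 2.
Proof. by rewrite /std_conic comp_mpolyB comp_mpolyM rmorphXn. Qed.

Definition torus (t : k) := mx3 t^-1 0 0 0 1 0 0 0 t.

Lemma det_torus t : t != 0 -> \det (torus t) = 1.
Proof. by move=> nz_t; rewrite det_mx3; field. Qed.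

Lemma comp_torusX t : 'X_i2 \mPo lin_forms (torus t) = t%:MP * 'X_i2.
Proof. by case: (comp_mx3 t^-1 0 0 0 1 0 0 0 t) => _ _ ->; rewrite mpolyC0; ring. Qed.

Lemma comp_torus_conic t : t != 0 -> std_conic \mPo lin_forms (torus t) = std_conic.
Proof.
move=> nz_t; rewrite comp_std_conic; case: (comp_mx3 t^-1 0 0 0 1 0 0 0 t) => -> -> ->.
rewrite mpolyC0 mpolyC1 /std_conic.
have E : (t^-1)%:MP_[3] * t%:MP = 1 by rewrite -mpolyCM mulVf.
move: (t^-1)%:MP_[3] t%:MP_[3] E => u v E.
transitivity (u * v * ('X_i0 * 'X_i2) - 'X_i1 ^+ 2); first by ring.
by rewrite E mul1r.
Qed.

(** The symmetric square of a unipotent 2 x 2 matrix: the reparametrization u -> u + s v of the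
    conic (u^2 : u v : v^2). *)
Definition unipotent (s : k) := mx3 1 (2%:R * s) (s ^+ 2) 0 1 s 0 0 1.

Lemma det_unipotent s : \det (unipotent s) = 1.
Proof. by rewrite det_mx3; ring. Qed.

Lemma comp_unipotentX s : 'X_i2 \mPo lin_forms (unipotent s) = 'X_i2.
Proof.
case: (comp_mx3 1 (2%:R * s) (s ^+ 2) 0 1 s 0 0 1) => _ _ ->.
by rewrite mpolyC0 mpolyC1; ring.
Qed.

Lemma comp_unipotent_conic s : std_conic \mPo lin_forms (unipotent s) = std_conic.
Proof.
rewrite comp_std_conic; case: (comp_mx3 1 (2%:R * s) (s ^+ 2) 0 1 s 0 0 1) => -> -> ->.
rewrite mpolyC0 mpolyC1 expr2 !mpolyCM /std_conic [2%:R%:MP](mpolyCMn _ 2 1) mpolyC1.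
ring.
Qed.

Lemma unipotent_inj : injective unipotent.
Proof. by move=> s t /matrixP/(_ i1 i2); rewrite !mxE. Qed.

(** The substitution is x -> x + i y, y -> i z, z -> x - i y. *)
Lemma std_conic_sumsq : (exists i : k, i ^+ 2 = -1) -> [pchar k] =i pred0 ->
  exists2 A, A \in unitmx & std_conic \mPo lin_forms A = sumsq k 3.
Proof.
move=> [i i2E] char0; exists (mx3 1 i 0 0 0 i 1 (- i) 0).
  rewrite unitmxE det_mx3 unitfE.
  have -> : 1 * (0 * 0 - i * - i) - i * (0 * 0 - i * 1) + 0 * (0 * - i - 0 * 1)
    = 2%:R * i ^+ 2.
    by ring.
  move/pcharf0P: char0 => natr_eq0.
  by rewrite i2E mulf_neq0 ?oppr_eq0 ?oner_eq0 // natr_eq0.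
rewrite comp_std_conic; case: (comp_mx3 1 i 0 0 0 i 1 (- i) 0) => -> -> ->.
rewrite mpolyC0 mpolyC1 mpolyCN /sumsq sum_ord3.
have E : i%:MP_[3] * i%:MP = -1 by rewrite -mpolyCM -expr2 i2E mpolyCN mpolyC1.
move: (i%:MP_[3]) E => u E.
transitivity ('X_i0 ^+ 2 - u * u * 'X_i1 ^+ 2 - u * u * 'X_i2 ^+ 2); first by ring.
by rewrite E !mulN1r !opprK.
Qed.
End StandardConic.

(** * One-parameter degenerations inside orbit closures *)

Section HomogeneousCurves.
Variables (k : closedFieldType).
Implicit Types (H : {poly {mpoly k[3]}}).

(** [H] is a family of forms of degree [d]; the variable of the outer polynomial is the parameter
    [t] of the torus. *)
Definition coef_homog d H := forall i, H`_i \is d.-homog.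

Lemma coef_homogC d p : p \is d.-homog -> coef_homog d p%:P.
Proof. by move=> homp i; rewrite coefC; case: eqP => // _; apply: dhomog0. Qed.

Lemma coef_homogX d H j : coef_homog d H -> coef_homog d (H * 'X^j).
Proof. by move=> homH i; rewrite coefMXn; case: ifP => // _; apply: dhomog0. Qed.

Lemma coef_homogD d H1 H2 :
  coef_homog d H1 -> coef_homog d H2 -> coef_homog d (H1 + H2).
Proof. by move=> hom1 hom2 i; rewrite coefD; apply: rpredD. Qed.

Lemma coef_homogM d1 d2 H1 H2 :
  coef_homog d1 H1 -> coef_homog d2 H2 -> coef_homog (d1 + d2) (H1 * H2).
Proof.
by move=> hom1 hom2 i; rewrite coefM; apply: rpred_sum => j _; apply: dhomogM.
Qed.

Lemma coef_homog_prod d n (H : 'I_n -> {poly {mpoly k[3]}}) :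
  (forall i, coef_homog d (H i)) -> coef_homog (d * n) (\prod_i H i).
Proof.
elim: n H => [|n IHn] H homH.
  by rewrite big_ord0 muln0; apply: coef_homogC; apply: dhomog1.
by rewrite big_ord_recl mulnS; apply: coef_homogM => //; apply: IHn.
Qed.

Lemma SL3_orbit_comp d (h g : ternary_form k d) (A : 'M[k]_3) : \det A = 1 ->
  mpoly_of_dhomog g = mpoly_of_dhomog h \mPo lin_forms A -> SL3_orbit h g.
Proof.
move=> detA gE; exists (invmx A); first by rewrite det_inv detA invr1.
by rewrite gE -[in LHS](invmxK A).
Qed.

Lemma det_conj (A B : 'M[k]_3) : A \in unitmx -> \det (A *m B *m invmx A) = \det B.
Proof.
move=> uA; rewrite !det_mulmx det_inv mulrAC divff ?mul1r //.
by rewrite -unitfE -unitmxE.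
Qed.

(** The torus conjugated by [A] stays in SL_3 and moves [h] along a polynomial curve in its orbit;
    the value at [t = 0] lies in the closure. *)
Lemma degeneration d (h : ternary_form k d) (A : 'M[k]_3) H :
    A \in unitmx -> coef_homog d H ->
    (forall t, t != 0 ->
       (mpoly_of_dhomog h \mPo lin_forms A) \mPo lin_forms (torus t) = H.[t%:MP]) ->
  exists2 f : ternary_form k d, zariski_closure (SL3_orbit h) f &
    mpoly_of_dhomog f \mPo lin_forms A = H`_0.
Proof.
move=> uA homH HE.
have hom i : H`_i \mPo lin_forms (invmx A) \is d.-homog.
  exact: dhomog_comp_lin_forms.
(* One index more than [size H], so that [ord0] exists even if [H = 0]. *)
pose g (i : 'I_(size H).+1) : ternary_form k d := DHomog (hom i).
exists (g ord0); last by rewrite /= comp_lin_formsVK.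
apply: zariski_closure_curve => t nz_t.
apply: (@SL3_orbit_comp _ _ _ (A *m torus t *m invmx A)).
  by rewrite det_conj // det_torus.
rewrite -!comp_lin_formsM HE //.
rewrite (horner_coef_wide _ (leqnSn (size H))) comp_mpoly_sum raddf_sum.
apply: eq_bigr => i _ /=.
by rewrite comp_mpolyM -mul_mpolyC rmorphXn /= -rmorphXn mulrC comp_mpolyC.
Qed.
End HomogeneousCurves.

(** * Stability of products of conics in normal form *)

Section NormalForm.
Variables (k : closedFieldType) (n : nat) (b : 'I_n -> k).

Definition conic_product : {mpoly k[3]} :=
  \prod_i (std_conic k + b i *: 'X_i2 ^+ 2).

(** The torus multiplies z^2 by t^2: this family joins [conic_product] at [t = 1] to the power of
    the standard conic at [t = 0]. *)
Let H : {poly {mpoly k[3]}} :=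
  \prod_i ((std_conic k)%:P + (b i *: 'X_i2 ^+ 2)%:P * 'X^2).

Let dhomog_Xn (j : 'I_3) e : ('X_j ^+ e : {mpoly k[3]}) \is e.-homog.
Proof. by rewrite -[X in X.-homog]mul1n; apply: dhomogMn; rewrite dhomogX /= mdeg1. Qed.

Let homog_H : coef_homog (2 * n) H.
Proof.
apply: coef_homog_prod => i; apply: coef_homogD.
  apply: coef_homogC; rewrite /std_conic; apply: rpredB.
    by rewrite -mpolyXD dhomogX /= mdegD !mdeg1.
  exact: dhomog_Xn.
by apply/coef_homogX/coef_homogC/dhomogZ/dhomog_Xn.
Qed.

Let H_torus t : t != 0 ->
  conic_product \mPo lin_forms (torus t) = H.[t%:MP].
Proof.
move=> nz_t; rewrite /conic_product rmorph_prod horner_prod.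
apply: eq_bigr => i _ /=.
rewrite comp_mpolyD comp_mpolyZ rmorphXn /= comp_torus_conic // comp_torusX.
by rewrite hornerD hornerM !hornerC hornerXn -scalerAl exprMn mulrC.
Qed.

Let H0 : H`_0 = std_conic k ^+ n.
Proof.
rewrite -horner_coef0 horner_prod (eq_bigr (fun=> std_conic k)).
  by rewrite prodr_const card_ord.
by move=> i _; rewrite hornerD hornerM !hornerC hornerXn expr0n mulr0 addr0.
Qed.

Lemma unstable_normal_form (h : ternary_form k (2 * n + 1)) (A : 'M[k]_3) c :
    A \in unitmx ->
    mpoly_of_dhomog h \mPo lin_forms A = c *: ('X_i2 * conic_product) ->
  unstable h.
Proof.
move=> uA hA; apply.
(* The line contributes a factor [t], so the limit is 0. *)
have [] := @degeneration k _ h A (c%:MP%:P * (H * (('X_i2)%:P * 'X^1))) uA.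
- rewrite -[(2 * n + 1)%N]add0n; apply: coef_homogM.
    apply: coef_homogC; rewrite -[c%:MP]mulr1 mul_mpolyC; apply/dhomogZ/dhomog1.
  apply: coef_homogM => //; apply/coef_homogX/coef_homogC.
  exact: (dhomog_Xn i2 1).
- move=> t nz_t; rewrite hA comp_mpolyZ comp_mpolyM H_torus // comp_torusX.
  by rewrite !hornerM !hornerC hornerXn expr1 -mul_mpolyC; ring.
move=> f clf; rewrite coefCM mulrA coefMXn ltnSn mulr0 => f0.
suff <- : f = 0 by [].
apply: val_inj => /=.
by rewrite -(comp_lin_formsK (mpoly_of_dhomog f) uA) f0 comp_mpoly0.
Qed.

Hypothesis char0 : [pchar k] =i pred0.

Lemma sqrt_closed (a : k) : exists i : k, i ^+ 2 = a.
Proof.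
have := @solve_monicpoly k 2 (fun j => if j == 0%N then a else 0) isT.
case=> i; rewrite !big_ord_recl big_ord0 /= mul0r !addr0 expr0 mulr1.
by exists i.
Qed.

(** The invariant is constant on the orbit closure, which contains a form equivalent to a nonzero
    multiple of [std_conic k ^+ n]. Its value there is nonzero, whereas it is 0 at the zero form. *)
Lemma semistable_normal_form (h : ternary_form k (2 * n)) (A : 'M[k]_3) c :
    A \in unitmx -> c != 0 ->
    mpoly_of_dhomog h \mPo lin_forms A = c *: conic_product ->
  semistable h.
Proof.
move=> uA nz_c hA cl0.
have [] := @degeneration k _ h A (c%:MP%:P * H) uA.
- rewrite -[(2 * n)%N]add0n; apply: coef_homogM => //.
  by apply: coef_homogC; rewrite -[c%:MP]mulr1 mul_mpolyC; apply/dhomogZ/dhomog1.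
- move=> t nz_t; rewrite hA comp_mpolyZ H_torus //.
  by rewrite hornerM hornerC mul_mpolyC.
move=> f clf; rewrite coefCM H0 mul_mpolyC => fA.
have [F FE] := @cat_invariant_polyfun k n (2 * n).
have F_cl g : zariski_closure (SL3_orbit h) g ->
    cat_invariant n (mpoly_of_dhomog g) = cat_invariant n (mpoly_of_dhomog h).
  move=> clg; have := clg (F - (cat_invariant n (mpoly_of_dhomog h))%:MP).
  rewrite /polyfun_eval !mevalB !mevalC -/(polyfun_eval F g) FE => clgF.
  apply/eqP; rewrite -subr_eq0 clgF // => s [B detB sE].
  rewrite mevalB mevalC -/(polyfun_eval F s) FE sE cat_invariant_SL3 ?subrr //.
  by rewrite det_inv detB invr1.
(* The determinant of an empty matrix would be 1; the monomial x^n shows that the size is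
   positive. *)
have Cat0 : cat_invariant n (mpoly_of_dhomog (0 : ternary_form k (2 * n))) = 0.
  have [|i _] := @monom_surj 3 n (U_(i0) *+ n)%MM.
    by rewrite mdegMn mdeg1 mul1n.
  have N_gt0 := leq_ltn_trans (leq0n i) (ltn_ord i).
  rewrite /cat_invariant linear0 -(scale0r (0 : {mpoly k[3]})) catalecticantZ detZ.
  by rewrite !expr0n -[_ == 0%N]negbK -lt0n N_gt0 mul0r expr0n.
have : cat_invariant n (mpoly_of_dhomog f) == 0 by rewrite F_cl // -(F_cl _ cl0) Cat0.
rewrite expf_eq0 /=; apply/negP.
have [B uB q_sq] := std_conic_sumsq (sqrt_closed (-1)) char0.
have : \det (catalecticant n
    ((mpoly_of_dhomog f \mPo lin_forms A) \mPo lin_forms B)) != 0.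
  rewrite fA comp_mpolyZ rmorphXn /= q_sq catalecticantZ detZ mulf_neq0 ?expf_neq0 //.
  exact: det_catalecticant_sumsq.
by rewrite !det_catalecticant_comp !mulf_eq0 !negb_or => /and3P[].
Qed.

(** In characteristic 0 the matrices [unipotent e%:R] are pairwise distinct, and their conjugates by
    [A] fix [h]; the list [s] is too short to hold [size s + 1] of them. *)
Lemma infinite_stabilizer (h : ternary_form k (2 * n)) (A : 'M[k]_3) c :
    A \in unitmx -> 
    mpoly_of_dhomog h \mPo lin_forms A = c *: conic_product ->
  ~ finite_SL3_stabilizer h.
Proof.
move=> uA hA [s stab].
pose B (e : nat) := invmx (A *m unipotent e%:R *m invmx A).
have detB e : \det (A *m unipotent e%:R *m invmx A) = 1.
  by rewrite det_conj // det_unipotent.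
have Bs e : B e \in s.
  apply: stab; first by rewrite det_inv detB invr1.
  rewrite /mx_act invmxK -/(lin_forms _) -!comp_lin_formsM hA.
  have -> : (c *: conic_product) \mPo lin_forms (unipotent e%:R) = c *: conic_product.
    rewrite comp_mpolyZ rmorph_prod; congr (_ *: _); apply: eq_bigr => i _ /=.
    by rewrite comp_mpolyD comp_mpolyZ rmorphXn /= comp_unipotent_conic comp_unipotentX.
  by rewrite -hA comp_lin_formsK.
have B_inj : injective B.
  move=> d e /(can_inj invmxK)/(congr1 (fun M => invmx A *m M *m A)).
  rewrite !mulmxA mulVmx // !mul1mx !mulmxKV // => /unipotent_inj/eqP.
  move/pcharf0P: char0 => natr_eq0.
  wlog le_de : d e / (d <= e)%N => [wlog_de|].
    have [/wlog_de|/ltnW/wlog_de wlog_ed] := leqP d e => // E.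
    by apply/esym/wlog_ed; rewrite eq_sym.
  rewrite eq_sym -subr_eq0 -natrB // natr_eq0 subn_eq0 => le_ed.
  by apply/eqP; rewrite eqn_leq le_de.
have : (size (map B (iota 0 (size s).+1)) <= size s)%N.
  apply: uniq_leq_size; first by rewrite map_inj_uniq ?iota_uniq.
  by move=> _ /mapP[e _ ->].
by rewrite size_map size_iota ltnn.
Qed.
End NormalForm.

(** * Conics in normal form *)

Section QuadraticForms.
Variables (k : fieldType) (n : nat).
Implicit Types (G A : 'M[k]_n) (v : 'rV[k]_n).

Definition quad G : {mpoly k[n]} := \sum_i \sum_j G i j *: ('X_i * 'X_j).

Lemma quadP c G1 G2 : quad (c *: G1 + G2) = c *: quad G1 + quad G2.
Proof.
rewrite /quad scaler_sumr -big_split; apply: eq_bigr => i _ /=.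
rewrite scaler_sumr -big_split; apply: eq_bigr => j _ /=.
by rewrite !mxE scalerDl scalerA.
Qed.

Lemma quad0 : quad 0 = 0.
Proof.
by rewrite /quad big1 // => i _; rewrite big1 // => j _; rewrite mxE scale0r.
Qed.

Lemma quad_tr G : quad G^T = quad G.
Proof.
rewrite /quad exchange_big; apply: eq_bigr => i _; apply: eq_bigr => j _.
by rewrite mxE mulrC.
Qed.

Lemma quad_delta i j : quad (delta_mx i j) = 'X_i * 'X_j.
Proof.
rewrite /quad (bigD1 i) //= (bigD1 j) //= mxE !eqxx scale1r !big1 ?addr0 //.
  by move=> i' /negPf ne_i; rewrite big1 // => j' _; rewrite mxE ne_i scale0r.
by move=> j' /negPf ne_j; rewrite mxE ne_j andbF scale0r.
Qed.

(** Any matrix representing [q] is averaged with its transpose. *)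
Lemma dhomog2_quad (q : {mpoly k[n]}) : 2%:R != 0 :> k -> q \is 2.-homog ->
  exists2 G, G^T = G & q = quad G.
Proof.
move=> nz2 /dhomogP homq.
have half : 2%:R^-1 + 2%:R^-1 = 1 :> k by field.
suff [B qB] : exists B, q = quad B.
  (* The trailing [0] gives the sum the shape that [quadP] rewrites. *)
  exists (2%:R^-1 *: B + (2%:R^-1 *: B^T + 0)).
    by rewrite !addr0 linearD !linearZ /= trmxK addrC.
  by rewrite !quadP quad_tr quad0 addr0 -scalerDl half scale1r.
rewrite (mpolyE q) big_seq; elim/big_ind: _ => [|_ _ [B1 ->] [B2 ->]|m m_q].
- by exists 0; rewrite quad0.
- by exists (1 *: B1 + B2); rewrite quadP scale1r.
have dm : mdeg m = 2%N := homq m m_q.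
have [i mi] := mdegS_ex dm.
have Em : (m - U_(i) + U_(i))%MM = m by apply: submK; rewrite lep1mP.
have /mdeg1P[j /eqP Ej]: mdeg (m - U_(i)) == 1%N.
  by move: dm; rewrite -{1}Em mdegD mdeg1; lia.
exists (q@_m *: delta_mx j i + 0); rewrite quadP quad_delta -mpolyXD -Ej Em.
by rewrite quad0 addr0.
Qed.

Lemma quad_comp G A : quad G \mPo lin_forms A = quad (A^T *m G *m A).
Proof.
pose T i j a b : {mpoly k[n]} := (A i a * G i j * A j b) *: ('X_a * 'X_b).
transitivity (\sum_i \sum_j \sum_a \sum_b T i j a b).
  rewrite /quad comp_mpoly_sum; apply: eq_bigr => i _.
  rewrite comp_mpoly_sum; apply: eq_bigr => j _.
  rewrite comp_mpolyZ comp_mpolyM !comp_lin_formsX mulr_suml scaler_sumr.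
  apply: eq_bigr => a _; rewrite mulr_sumr scaler_sumr; apply: eq_bigr => b _.
  by rewrite -scalerAl -scalerAr !scalerA [G i j * _]mulrC.
transitivity (\sum_a \sum_i \sum_j \sum_b T i j a b).
  by rewrite [RHS]exchange_big; apply: eq_bigr => i _; exact: exchange_big.
apply: eq_bigr => a _; transitivity (\sum_b \sum_i \sum_j T i j a b).
  by rewrite [RHS]exchange_big; apply: eq_bigr => i _; exact: exchange_big.
apply: eq_bigr => b _; rewrite mxE exchange_big scaler_suml; apply: eq_bigr => j _.
rewrite mxE mulr_suml scaler_suml; apply: eq_bigr => i _.
by rewrite !mxE.
Qed.

Lemma meval_quad G v : (quad G).@[v 0] = (v *m G *m v^T) 0 0.
Proof.
rewrite mxE; under [RHS]eq_bigr do rewrite mxE mulr_suml.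
rewrite [RHS]exchange_big /quad raddf_sum; apply: eq_bigr => i _ /=.
rewrite raddf_sum; apply: eq_bigr => j _ /=.
by rewrite mevalZ mevalM !mevalXU !mxE; ring.
Qed.

Lemma mderiv_quad G v i : G^T = G ->
  ((quad G)^`M(i)).@[v 0] = 2%:R * (v *m G) 0 i.
Proof.
move=> symG; rewrite /quad (raddf_sum (mderiv i)) (raddf_sum (meval (v 0))) /=.
have D a b : ((G a b *: ('X_a * 'X_b))^`M(i)).@[v 0] =
    (a == i)%:R * (G i b * v 0 b) + (b == i)%:R * (G a i * v 0 a).
  rewrite mderivZ mderivM !mderivXU mevalZ mevalD !mevalM !mevalC !mevalXU.
  by case: eqP => [->|_]; case: eqP => [->|_] /=; ring.
under eq_bigr do rewrite (raddf_sum (mderiv i)) (raddf_sum (meval (v 0))) /=.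
under eq_bigr => a _ do under eq_bigr do rewrite D.
under eq_bigr do rewrite big_split /=.
rewrite big_split /= mulr_natl mulr2n; congr (_ + _).
  rewrite (bigD1 i) //= [X in _ + X]big1 => [|a /negPf ne_a].
    rewrite addr0 mxE; apply: eq_bigr => b _.
    by rewrite eqxx mul1r mulrC -{1}symG mxE.
  by rewrite big1 // => b _; rewrite ne_a mul0r.
rewrite mxE; apply: eq_bigr => a _.
rewrite (bigD1 i) //= [X in _ + X]big1 => [|b /negPf ne_b]; last by rewrite ne_b mul0r.
by rewrite eqxx mul1r addr0 mulrC.
Qed.
End QuadraticForms.

Section ConicNormalForm.
Variable k : closedFieldType.
Hypothesis char0 : [pchar k] =i pred0.
Implicit Types (u v w P : 'rV[k]_3) (q : {mpoly k[3]}).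

Let nz2 : 2%:R != 0 :> k.
Proof. by move/pcharf0P: char0 => ->. Qed.

(** The gradient of [quad G] at [v] is [2 v G], so a kernel vector of [G] would be a singular
    point. *)
Lemma smooth_conic_quad q : smooth_conic q ->
  exists G, [/\ G^T = G, G \in unitmx & q = quad G].
Proof.
move=> [_ homq smq]; have [G symG qG] := dhomog2_quad nz2 homq.
exists G; split=> //; rewrite unitmxE unitfE; apply/negP => /det0P[v nz_v vG0].
have [|i] := smq v nz_v.
  by rewrite /on_curve qG meval_quad vG0 mul0mx mxE.
by rewrite qG mderiv_quad // vG0 mxE mulr0 eqxx.
Qed.

Section Basis.
Variable G : 'M[k]_3.
Hypotheses (symG : G^T = G) (uG : G \in unitmx).

Let bil u v := (u *m G *m v^T) 0 0.

Let bilC u v : bil u v = bil v u.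
Proof.
rewrite /bil -[in LHS](trmxK (u *m G *m v^T)) mxE !trmx_mul trmxK symG.
by rewrite mulmxA.
Qed.

Let bilDl c u v w : bil (c *: u + v) w = c * bil u w + bil v w.
Proof. by rewrite /bil !mulmxDl -!scalemxAl !mxE. Qed.

Let bilDr c u v w : bil w (c *: u + v) = c * bil w u + bil w v.
Proof. by rewrite bilC bilDl ![bil _ w]bilC. Qed.

Let bilZ c d u v : bil (c *: u) (d *: v) = c * d * bil u v.
Proof. by rewrite /bil linearZ -scalemxAr -!scalemxAl !mxE; ring. Qed.

Definition rows3 u v w : 'M[k]_3 := \matrix_(i, j) (nth 0 [:: u; v; w] i) 0 j.

Let gram_rows3 u v w :
  rows3 u v w *m G *m (rows3 u v w)^T =
  mx3 (bil u u) (bil u v) (bil u w) (bil v u) (bil v v) (bil v w)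
      (bil w u) (bil w v) (bil w w).
Proof.
have E (M : 'M[k]_3) i j : (M *m G *m M^T) i j = bil (row i M) (row j M).
  rewrite /bil -row_mul !mxE; apply: eq_bigr => l _; by rewrite !mxE.
have row0 : row i0 (rows3 u v w) = u by apply/rowP => j; rewrite !mxE.
have row1 : row i1 (rows3 u v w) = v by apply/rowP => j; rewrite !mxE.
have row2 : row i2 (rows3 u v w) = w by apply/rowP => j; rewrite !mxE.
by rewrite [LHS]mx3E !E row0 row1 row2.
Qed.

(** [P] is completed to a hyperbolic pair [P], [w], and a vector [v] orthogonal to both is scaled to
    square -1. The target is the Gram matrix of xz - y^2. *)
Lemma isotropic_basis P : P != 0 -> bil P P = 0 ->
  exists A, [/\ A \in unitmx, forall i, A i i0 = P 0 i &
    A^T *m G *m A = mx3 0 0 2%:R^-1 0 (-1) 0 2%:R^-1 0 0].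
Proof.
move=> nzP PP.
have bil_ex u : u != 0 -> exists w, bil u w = 2%:R^-1.
  move=> nz_u; have : u *m G != 0.
    by apply: contraNneq nz_u => uG0; rewrite -(mulmxK uG u) uG0 mul0mx.
  case/rV0Pn=> j nz_j; exists ((2%:R^-1 / (u *m G) 0 j) *: delta_mx 0 j).
  by rewrite -{1}[u]scale1r bilZ mul1r /bil trmx_delta -colE [col _ _ _ _]mxE mulfVK.
have [w2 Pw2] := bil_ex P nzP.
(* The multiple of [P] cancels [bil w2 w2], because [2 * bil P w2 = 1]. *)
pose w := - bil w2 w2 *: P + w2.
have Pw : bil P w = 2%:R^-1 by rewrite /w bilDr PP mulr0 add0r.
have ww : bil w w = 0.
  rewrite {1}/w bilDl Pw [bil w2 w]bilC /w bilDl Pw2; by field.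
(* The zero third row forces a kernel vector; it is orthogonal to [P] and [w]. *)
have [v nz_v] : exists2 v : 'rV[k]_3, v != 0 & v *m (G *m (rows3 P w 0)^T) = 0.
  apply/det0P; rewrite det_mulmx det_tr [\det (rows3 _ _ _)](expand_det_row _ i2).
  rewrite big1 ?mulr0 // => j _.
  by rewrite !mxE mul0r.
rewrite mulmxA => /rowP orth.
have bil_row M i : (v *m G *m M^T) 0 i = bil v (row i M).
  by rewrite /bil !mxE; apply: eq_bigr => l _; rewrite !mxE.
have vP : bil v P = 0.
  have := orth i0; rewrite bil_row mxE (_ : row _ _ = P) //.
  by apply/rowP => j; rewrite !mxE.
have vw : bil v w = 0.
  have := orth i1; rewrite bil_row mxE (_ : row _ _ = w) //.
  by apply/rowP => j; rewrite !mxE.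
(* An isotropic [v] would be orthogonal to the basis [P], [v], [w], against the invertibility of
   [G]. *)
have nz_vv : bil v v != 0.
  apply/eqP => vv.
  have uR : rows3 P v w \in unitmx.
    rewrite unitmxE unitfE; apply/negP => /det0P[c nz_c cR].
    have := gram_rows3 P v w; rewrite PP ww vv vP vw Pw [bil w P]bilC Pw.
    rewrite [bil P v]bilC vP [bil w v]bilC vw => /(congr1 (mulmx c)).
    rewrite !mulmxA cR !mul0mx => /esym/rowP c0.
    have nzh : 2%:R^-1 != 0 :> k by rewrite invr_eq0.
    have := c0 i2; rewrite mxE sum_ord3 !mxE /= !mulr0 !addr0 => /eqP.
    rewrite mulf_eq0 (negPf nzh) orbF => /eqP c00.
    have := c0 i0; rewrite mxE sum_ord3 !mxE /= !mulr0 !add0r => /eqP.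
    rewrite mulf_eq0 (negPf nzh) orbF => /eqP c02.
    case/rV0Pn: nz_v => j nz_vj; move/rowP: cR => /(_ j).
    rewrite mxE sum_ord3 !mxE /= c00 c02 !mul0r addr0 add0r => /eqP.
    rewrite mulf_eq0 (negPf nz_vj) orbF => /eqP c01; case/eqP: nz_c.
    by apply/rowP; apply: ord3P; rewrite mxE.
  have : v *m G *m (rows3 P v w)^T = 0.
    have rowsE : row i0 (rows3 P v w) = P /\ row i1 (rows3 P v w) = v
                 /\ row i2 (rows3 P v w) = w.
      by do !split; apply/rowP => j; rewrite !mxE.
    case: rowsE => R0 [R1 R2].
    by apply/rowP; apply: ord3P; rewrite bil_row mxE ?R0 ?R1 ?R2.
  move/(congr1 (fun M => M *m invmx (rows3 P v w)^T *m invmx G)).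
  by rewrite mulmxK ?unitmx_tr // mulmxK // !mul0mx => v0; rewrite v0 eqxx in nz_v.
have [s s2] := sqrt_closed (- (bil v v)^-1).
pose A := (rows3 P (s *: v) w)^T.
have AGA : A^T *m G *m A = mx3 0 0 2%:R^-1 0 (-1) 0 2%:R^-1 0 0.
  rewrite /A trmxK gram_rows3 PP ww Pw [bil w P]bilC Pw bilZ -expr2 s2 mulNr mulVf //.
  have sv u : bil v u = 0 -> bil (s *: v) u = 0.
    by move=> vu; rewrite -[u]scale1r bilZ vu mulr0.
  by rewrite [bil P _]bilC [bil w (s *: v)]bilC !sv.
exists A; split=> //; last by move=> i; rewrite !mxE.
have : A^T *m G *m A \in unitmx.
  rewrite AGA unitmxE det_mx3 unitfE.
  by rewrite !mul0r subrr !add0r mulN1r opprK mulf_neq0 ?invr_eq0.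
by rewrite unitmx_mul => /andP[].
Qed.
End Basis.

(** With [P] as first column of [A], the point becomes (1 : 0 : 0) in the new coordinates. *)
Lemma conic_normal_form q P : smooth_conic q -> P != 0 -> on_curve P q ->
  exists A, [/\ A \in unitmx, forall i, A i i0 = P 0 i &
                q \mPo lin_forms A = std_conic k].
Proof.
move=> smq nzP; have [G [symG uG ->]] := smooth_conic_quad smq.
rewrite /on_curve meval_quad => PP.
have [A [uA AP AGA]] := isotropic_basis symG uG nzP PP.
exists A; split=> //; rewrite quad_comp AGA /quad !sum_ord3 !mxE /= !scale0r.
rewrite !add0r !addr0 scaleN1r /std_conic ['X_i2 * _]mulrC.
rewrite addrAC -scalerDl (_ : 2%:R^-1 + 2%:R^-1 = 1) ?scale1r //.
by field.
Qed.
End ConicNormalForm.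

(** * Intersection multiplicity *)

(* With denominators cleared: no nontrivial combination of the [a i], divided by
   a form not vanishing at P, lies in the local ideal of [f] and [g]. *)
Definition independent_mod (k : fieldType) (P : 'I_3 -> k) (f g : {mpoly k[3]})
    (m : nat) (a : 'I_m -> {mpoly k[3]}) : Prop :=
  forall (c : 'rV[k]_m) (e : nat) (b u v : {mpoly k[3]}),
    b \is e.-homog -> b.@[P] != 0 ->
    b * (\sum_i c 0 i *: a i) = u * f + v * g -> c = 0.

(** The basis is written over a common denominator [B]. A relation between the numerators [a'] gives
    coordinates of the class of 0, which are unique, hence zero. *)
Lemma intersection_multiplicity_independent (k : fieldType) (P : 'rV[k]_3)
    (f g : {mpoly k[3]}) m :
  intersection_multiplicity P f g m ->
  exists (d : nat) (a : 'I_m -> {mpoly k[3]}),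
    (forall i, a i \is d.-homog) /\ independent_mod (P 0) f g a.
Proof.
move=> [e [/fin_all_exists[d /fin_all_exists[a /fin_all_exists[b loc]]] basis]].
pose B := \prod_i b i.
pose a' i := a i * \prod_(j | j != i) b j.
have nzb i : b i != 0.
  by have [_ _ nzbP _] := loc i; apply: contraNneq nzbP => ->; rewrite meval0.
have nzB : B.@[P 0] != 0.
  rewrite /B rmorph_prod; apply/prodf_neq0 => i _; by case: (loc i).
have nzB0 : B != 0 by apply: contraNneq nzB => ->; rewrite meval0.
have homB : B \is (\sum_i d i)%N.-homog.
  by apply: dhomog_prodn => i; case: (loc i).
have hom_a' i : a' i \is (\sum_i d i)%N.-homog.
  rewrite (bigD1 i) //=; apply: dhomogM; first by case: (loc i).
  apply: (big_ind2 (fun p e => p \is e.-homog)) => [|p1 e1 p2 e2|j _].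
  - exact: dhomog1.
  - exact: dhomogM.
  - by case: (loc j).
have eE i : e i = tofrac (a' i) / tofrac B.
  have [_ _ _ ->] := loc i.
  have -> : B = b i * \prod_(j | j != i) b j by rewrite /B (bigD1 i).
  rewrite (tofracM (a i)) (tofracM (b i)) -mulf_div divff ?mulr1 //.
  by rewrite tofrac_eq0; apply/prodf_neq0 => j _.
exists (\sum_i d i)%N, a'; split=> // c n p u v homp nzp E.
have loc0 : local_ring P 0.
  exists 0%N, 0, 1; split; rewrite ?dhomog0 ?dhomog1 ?meval1 ?oner_eq0 //.
  by rewrite tofrac0 mul0r.
have [c0 [_ uniq0]] := basis 0 loc0.
have <- : c0 = 0.
  apply: uniq0; exists 0%N, 0, 1, 0, 0.
  split; rewrite ?dhomog0 ?dhomog1 ?meval1 ?oner_eq0 ?mul0r ?addr0 //.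
  rewrite sub0r big1 ?oppr0 // => i _.
  by rewrite mxE mpolyC0 tofrac0 mul0r.
apply/esym/uniq0.
have nzp0 : p != 0 by apply: contraNneq nzp => ->; rewrite meval0.
exists (n + \sum_i d i)%N, (- (p * \sum_i c 0 i *: a' i)), (p * B), (- u), (- v).
split.
- by rewrite E opprD !mulNr.
- rewrite rpredN; apply: dhomogM => //; apply: rpred_sum => i _.
  exact: dhomogZ.
- exact: dhomogM.
- by rewrite mevalM mulf_neq0.
rewrite sub0r tofracN mulNr; congr (- _).
rewrite !tofracM -mulf_div divff ?mul1r ?tofrac_eq0 // rmorph_sum mulr_suml.
apply: eq_bigr => i _.
by rewrite eE -mul_mpolyC [X in _ = X / _](tofracM (c 0 i)%:MP (a' i)) mulrA.
Qed.

(** * Order of contact with the standard conic *)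

Section ContactWithStandardConic.
Variable k : fieldType.
Implicit Types (p q R : {mpoly k[3]}) (r : {poly k}).

Local Notation x := ('X_i0 : {mpoly k[3]}).
Local Notation y := ('X_i1 : {mpoly k[3]}).
Local Notation z := ('X_i2 : {mpoly k[3]}).

(* The restriction [p(1, s, s^2)] to the parametrized standard conic: the
   ordinal [i] is read as an exponent. *)
Definition conic_param p : {poly k} := mmap polyC (fun i : 'I_3 => 'X^i) p.

(** This is [r(y/x) * x^N], with the coefficients of [r] above [N] dropped; [s = y/x] is the
    parameter of the conic. *)
Definition homogenize (N : nat) r : {mpoly k[3]} :=
  \sum_(j < N.+1) r`_j *: (x ^+ (N - j) * y ^+ j).

Lemma conic_paramP c p q :
  conic_param (c *: p + q) = c *: conic_param p + conic_param q.
Proof. by rewrite /conic_param mmapD mmapZ mul_polyC. Qed.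

Lemma conic_param0 : conic_param 0 = 0. Proof. exact: mmap0. Qed.

Lemma conic_param_sum (I : Type) (s : seq I) (c : I -> k) (F : I -> {mpoly k[3]}) :
  conic_param (\sum_(i <- s) c i *: F i) = \sum_(i <- s) c i *: conic_param (F i).
Proof.
elim: s => [|i s IHs]; first by rewrite !big_nil conic_param0.
by rewrite !big_cons conic_paramP IHs.
Qed.

Lemma conic_paramX m : conic_param 'X_[m] = 'X^(m i1 + 2 * m i2).
Proof.
rewrite /conic_param mmapX /mmap1 prod_ord3 expr0 expr1n mul1r expr1 -exprM.
by rewrite -exprD.
Qed.

Lemma homogenizeP N c r1 r2 :
  homogenize N (c *: r1 + r2) = c *: homogenize N r1 + homogenize N r2.
Proof.
rewrite /homogenize scaler_sumr -big_split; apply: eq_bigr => j _ /=.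
by rewrite coefD coefZ scalerDl scalerA.
Qed.

Lemma homogenize0 N : homogenize N 0 = 0.
Proof. by rewrite /homogenize big1 // => j _; rewrite coef0 scale0r. Qed.

Lemma homogenizeX N e : (e <= N)%N -> homogenize N 'X^e = x ^+ (N - e) * y ^+ e.
Proof.
rewrite -ltnS => lt_e; rewrite /homogenize (bigD1 (Ordinal lt_e)) //= big1.
  by rewrite coefXn eqxx scale1r addr0.
by move=> j /negPf; rewrite -val_eqE /= coefXn => ->; rewrite scale0r.
Qed.

(** Modulo the conic xz is y^2, so x^d times x^a y^b z^c becomes x^(2a+b) y^(b+2c) when a + b + c =
    d. *)
Lemma mod_std_conic d p : p \is d.-homog ->
  exists u, x ^+ d * p = u * std_conic k + homogenize (2 * d) (conic_param p).
Proof.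
move=> /dhomogP homp; rewrite (mpolyE p) big_seq.
pose K q := exists u, x ^+ d * q = u * std_conic k + homogenize (2 * d) (conic_param q).
apply: (big_ind K) => [|q1 q2 [u1 E1] [u2 E2]|m /homp dm].
- by exists 0; rewrite mulr0 mul0r add0r conic_param0 homogenize0.
- exists (u1 + u2); rewrite mulrDr E1 E2 -[q1 in RHS]scale1r conic_paramP.
  by rewrite homogenizeP scale1r; ring.
have {}dm : (m i0 + m i1 + m i2)%N = d by rewrite -[RHS]dm /= mdegE sum_ord3.
have mE : 'X_[m] = x ^+ m i0 * y ^+ m i1 * z ^+ m i2.
  by rewrite mpolyXE_id prod_ord3.
(* The quotient of (xz)^c - (y^2)^c by xz - y^2, with c = [m i2]. *)
pose S := \sum_(i < m i2) (x * z) ^+ ((m i2).-1 - i) * (y ^+ 2) ^+ i.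
have powE : (x * z) ^+ m i2 = std_conic k * S + (y ^+ 2) ^+ m i2.
  by rewrite /S -subrXX subrK.
exists (p@_m *: (x ^+ (2 * m i0 + m i1) * y ^+ m i1 * S)).
have -> : conic_param (p@_m *: 'X_[m]) = p@_m *: conic_param 'X_[m] + 0.
  by rewrite -conic_param0 -conic_paramP addr0.
rewrite homogenizeP homogenize0 addr0 conic_paramX homogenizeX; last by lia.
rewrite -scalerAr -scalerAl -scalerDr; congr (_ *: _).
have -> : x ^+ d * 'X_[m] = x ^+ (2 * m i0 + m i1) * y ^+ m i1 * (x * z) ^+ m i2.
  rewrite mE -dm exprMn.
  have -> : (2 * m i0 + m i1 = m i0 + (m i0 + m i1))%N by lia.
  rewrite !exprD; ring.
rewrite powE mulrDr; congr (_ + _); first by ring.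
have -> : (2 * d - (m i1 + 2 * m i2) = 2 * m i0 + m i1)%N by lia.
by rewrite -exprM -mulrA -exprD.
Qed.

(** The quotient of [homogenize N r] by y^e when [r] vanishes to order [e]; the truncated [j - e]
    then meets only zero coefficients. *)
Definition quotient_form N e r : {mpoly k[3]} :=
  \sum_(j < N.+1) r`_j *: (x ^+ (N - j) * y ^+ (j - e)).

Section Quotient.
Variables (N e : nat) (r : {poly k}).
Hypotheses (e_le_N : (e <= N)%N) (r_lt0 : forall j, (j < e)%N -> r`_j = 0).

Lemma quotient_formE : homogenize N r = y ^+ e * quotient_form N e r.
Proof.
rewrite /homogenize mulr_sumr; apply: eq_bigr => j _.
have [/r_lt0->|le_ej] := ltnP j e; first by rewrite !scale0r mulr0.
by rewrite -scalerAr mulrCA -exprD subnKC.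
Qed.

Lemma dhomog_quotient_form : quotient_form N e r \is (N - e).-homog.
Proof.
apply: rpred_sum => j _.
have [/r_lt0->|le_ej] := ltnP j e; first by rewrite scale0r dhomog0.
apply: dhomogZ; have -> : (N - e = 1 * (N - j) + 1 * (j - e))%N.
  by have := ltn_ord j; lia.
by apply: dhomogM; apply: dhomogMn; rewrite dhomogX /= mdeg1.
Qed.

Lemma meval_quotient_form :
  (quotient_form N e r).@[fun i => (i == i0)%:R] = r`_e.
Proof.
have lt_e : (e < N.+1)%N by [].
rewrite /quotient_form raddf_sum (bigD1 (Ordinal lt_e)) //= big1 => [|j ne_je].
  by rewrite mevalZ mevalM !rmorphXn /= !mevalXU subnn expr0 expr1n !mulr1 addr0.
have [/r_lt0->|le_ej] := ltnP j e; first by rewrite scale0r meval0.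
have lt_ej : (e < j)%N by rewrite ltn_neqAle le_ej andbT eq_sym.
rewrite mevalZ mevalM !rmorphXn /= !mevalXU expr0n subn_eq0 leqNgt lt_ej.
by rewrite !mulr0.
Qed.
End Quotient.

(** Otherwise let s^j, j < 4, be the first term of [R] on the conic. Some nontrivial combination [p]
    of the four [a i] also vanishes there to order [j]. As [R] is locally y^j times a unit modulo
    the conic, [p] lies in the local ideal, against independence. *)
Lemma contact_order4 d R (a : 'I_4 -> {mpoly k[3]}) :
    R \is 2.-homog -> (forall i, a i \is d.-homog) ->
    independent_mod (fun i => (i == i0)%:R) (std_conic k) R a ->
  forall j, (j < 4)%N -> (conic_param R)`_j = 0.
Proof.
move=> homR homa indep; elim/ltn_ind => j IHj lt_j4.
apply/eqP/negPn/negP => nz_rj.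
(* The last column is zero because [j < 4], so [M] is singular. *)
pose M : 'M[k]_4 := \matrix_(i, l) if (l < j)%N then (conic_param (a i))`_l else 0.
have [c nz_c cM] : exists2 c : 'rV[k]_4, c != 0 & c *m M = 0.
  apply/det0P; rewrite (expand_det_col _ ord_max) big1 // => i _.
  by rewrite mxE ltnNge -ltnS lt_j4 mul0r.
pose p := \sum_i c 0 i *: a i.
have homp : p \is d.-homog by apply: rpred_sum => i _; apply: dhomogZ.
have p_lt0 l : (l < j)%N -> (conic_param p)`_l = 0.
  move=> lt_lj; have lt_l4 := ltn_trans lt_lj lt_j4.
  move/rowP/(_ (Ordinal lt_l4)): cM; rewrite !mxE => cM.
  rewrite -[RHS]cM /p conic_param_sum coef_sum; apply: eq_bigr => i _.
  by rewrite coefZ mxE /= lt_lj.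
have R_lt0 l : (l < j)%N -> (conic_param R)`_l = 0.
  by move=> lt_lj; apply: IHj => //; apply: ltn_trans lt_j4.
have [u uE] := mod_std_conic homp; have [v vE] := mod_std_conic homR.
rewrite (quotient_formE _ p_lt0) in uE; rewrite (quotient_formE _ R_lt0) in vE.
case/eqP: nz_c; set B := quotient_form _ _ (conic_param R) in vE.
set V := quotient_form _ _ _ in uE.
(* With q the conic, y^j is eliminated from x^d p = u q + y^j V and x^2 R = v q + y^j B. The value
   of [B] at the point is the nonzero coefficient of s^j. *)
apply: (indep c _ (x ^+ d * B) (B * u - V * v) (V * x ^+ 2)).
- apply: dhomogM; last by apply: dhomog_quotient_form => //; lia.
  by apply: dhomogMn; rewrite dhomogX /= mdeg1.
- rewrite mevalM rmorphXn /= mevalXU expr1n mul1r meval_quotient_form //; lia.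
rewrite -/p [LHS](_ : _ = B * (x ^+ d * p)); last by ring.
rewrite uE -[V * x ^+ 2 * R]mulrA vE; ring.
Qed.
End ContactWithStandardConic.

(** * Simultaneous normal form of hyperosculating conics *)

Section HyperosculatingConics.
Variable k : closedFieldType.
Hypothesis char0 : [pchar k] =i pred0.
Implicit Types (P : 'rV[k]_3) (f g l : {mpoly k[3]}) (A G : 'M[k]_3).

Let e0 : 'I_3 -> k := fun i => (i == i0)%:R.

Let mul_e0 A P : (forall i, A i i0 = P 0 i) -> forall i, \sum_j A i j * e0 j = P 0 i.
Proof. by move=> AP i; rewrite sum_ord3 /e0 /= !mulr0 !addr0 mulr1. Qed.

(** On (1, s, s^2) the coefficients of degree 0 to 3 are G00, 2 G01, 2 G02 + G11 and 2 G12. *)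
Lemma quad_contact G : G^T = G ->
    (forall j, (j < 4)%N -> (conic_param (quad G))`_j = 0) ->
  [/\ G i0 i0 = 0, G i0 i1 = 0 &
      quad G = (2%:R * G i0 i2) *: std_conic k + G i2 i2 *: 'X_i2 ^+ 2].
Proof.
move=> symG; have symGE i j : G j i = G i j by rewrite -{1}symG mxE.
pose pX i j : {poly k} := 'X^(i + j).
have -> : conic_param (quad G) = \sum_(i < 3) \sum_(j < 3) G i j *: pX i j.
  transitivity (conic_param (\sum_i 1 *: \sum_j G i j *: 'X_[U_(i) + U_(j)])).
    congr conic_param; apply: eq_bigr => i _; rewrite scale1r.
    by apply: eq_bigr => j _; rewrite mpolyXD.
  rewrite conic_param_sum; apply: eq_bigr => i _; rewrite scale1r conic_param_sum.
  apply: eq_bigr => j _; rewrite conic_paramX /pX !mnmDE !mnm1E.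
  by congr (_ *: 'X^_); move: i j; apply: ord3P; apply: ord3P.
rewrite !sum_ord3 => c0.
have nz2 : 2%:R != 0 :> k by move/pcharf0P: char0 => ->.
have := c0 0%N isT; have := c0 1%N isT; have := c0 2%N isT; have := c0 3%N isT.
rewrite !coefD !coefZ !coefXn /= !mulr0 !mulr1 !addr0 !add0r.
rewrite (symGE i0 i1) (symGE i0 i2) (symGE i1 i2) => E3 E2 E1 E0.
have G01 : G i0 i1 = 0.
  by apply/eqP; move/eqP: E1; rewrite -mulr2n -mulr_natl mulf_eq0 (negPf nz2).
have G12 : G i1 i2 = 0.
  by apply/eqP; move/eqP: E3; rewrite -mulr2n -mulr_natl mulf_eq0 (negPf nz2).
have G11 : G i1 i1 = - (2%:R * G i0 i2).
  by apply/eqP; rewrite -addr_eq0 -[X in _ == X]E2; apply/eqP; ring.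
split=> //; rewrite /quad !sum_ord3 (symGE i0 i1) (symGE i0 i2) (symGE i1 i2).
rewrite E0 G01 G12 G11 /std_conic -!mul_mpolyC !mpolyC0 mpolyCN mpolyCM.
rewrite [2%:R%:MP](mpolyCMn _ 2 1) mpolyC1; ring.
Qed.

Lemma independent_mod_comp A P f g m (a : 'I_m -> {mpoly k[3]}) :
    A \in unitmx -> (forall i, A i i0 = P 0 i) ->
    independent_mod (P 0) f g a ->
  independent_mod e0 (f \mPo lin_forms A) (g \mPo lin_forms A)
    (fun i => a i \mPo lin_forms A).
Proof.
move=> uA AP indep c e b u v homb nzb E.
apply: (indep c e (b \mPo lin_forms (invmx A)) (u \mPo lin_forms (invmx A))
  (v \mPo lin_forms (invmx A))).
- exact: dhomog_comp_lin_forms.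
- rewrite -(@meval_eq _ _ (fun i => \sum_j A i j * e0 j)); last exact: mul_e0.
  by rewrite -meval_comp_lin_forms comp_lin_formsVK.
rewrite -[f](comp_lin_formsK _ uA) -[g](comp_lin_formsK _ uA).
rewrite -!comp_mpolyM -comp_mpolyD -E.
rewrite comp_mpolyM comp_mpoly_sum; congr (_ * _); apply: eq_bigr => i _.
by rewrite comp_mpolyZ comp_lin_formsK.
Qed.

Lemma hyperosculating_pair A P f g :
    A \in unitmx -> (forall i, A i i0 = P 0 i) ->
    smooth_conic g -> f \mPo lin_forms A = std_conic k ->
    intersection_multiplicity P f g 4 ->
  exists c b, c != 0 /\ g \mPo lin_forms A = c *: (std_conic k + b *: 'X_i2 ^+ 2).
Proof.
move=> uA AP smg fA /intersection_multiplicity_independent[d [a [homa indep]]].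
have [_ homg _] := smg.
have [G [symG uG gG]] := smooth_conic_quad char0 smg.
have indepA := independent_mod_comp uA AP indep; rewrite fA in indepA.
have := contact_order4 (dhomog_comp_lin_forms A homg)
  (fun i => dhomog_comp_lin_forms A (homa i)) indepA.
rewrite gG quad_comp; set G' := A^T *m G *m A => c0.
have symG' : G'^T = G' by rewrite /G' !trmx_mul trmxK symG mulmxA.
have [G00 G01 ->] := quad_contact symG' c0.
have nz2 : 2%:R != 0 :> k by move/pcharf0P: char0 => ->.
(* Otherwise the first row of [G'] would vanish, while smoothness makes [G'] invertible. *)
have nz02 : 2%:R * G' i0 i2 != 0.
  have : \det G' != 0 by rewrite -unitfE -unitmxE /G' !unitmx_mul unitmx_tr uA uG.
  apply: contraNneq => /eqP; rewrite mulf_eq0 (negPf nz2) => /eqP G02.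
  by rewrite (mx3E G') det_mx3 G00 G01 G02 !mul0r subrr addr0.
exists (2%:R * G' i0 i2), (G' i2 i2 / (2%:R * G' i0 i2)); split=> //.
by rewrite [RHS]scalerDr scalerA mulrCA divff ?mulr1.
Qed.

(** [Q i] is the reference conic, with [b i = 0]; the others follow from their contact with it. *)
Lemma hyperosculating_normal_form n P (Q : 'I_n -> {mpoly k[3]}) (i : 'I_n) :
    P != 0 -> hyperosculating_conics P Q ->
  exists A c (b : 'I_n -> k),
    [/\ A \in unitmx, c != 0, forall i, A i i0 = P 0 i,
        Q i \mPo lin_forms A = std_conic k &
        (\prod_j Q j) \mPo lin_forms A = c *: conic_product b].
Proof.
move=> nzP [smQ PQ multQ].
have [A [uA AP QiA]] := conic_normal_form char0 (smQ i) nzP (PQ i).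
have /fin_all_exists2[g g0 /fin_all_exists[b gb]] :
  forall j, exists2 c, c != 0 & exists b,
    Q j \mPo lin_forms A = c *: (std_conic k + b *: 'X_i2 ^+ 2).
  move=> j; have [<-|ne_ij] := eqVneq i j.
    by exists 1; rewrite ?oner_eq0 //; exists 0; rewrite scale0r addr0 scale1r.
  have [c [b [nz_c E]]] := hyperosculating_pair uA AP (smQ j) QiA (multQ _ _ ne_ij).
  by exists c => //; exists b.
exists A, (\prod_j g j), b; split=> //.
  by apply/prodf_neq0 => j _; apply: g0.
rewrite rmorph_prod /conic_product -scaler_prod; apply: eq_bigr => j _; exact: gb.
Qed.

(** By the chain rule tangent lines follow the change of coordinates; for the standard conic at (1 :
    0 : 0) the result is z. *)
Lemma comp_tangent_form A P f : (forall i, A i i0 = P 0 i) ->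
  tangent_form f P \mPo lin_forms A =
    \sum_j ((f \mPo lin_forms A)^`M(j)).@[e0] *: 'X_j.
Proof.
move=> AP; rewrite /tangent_form comp_mpoly_sum.
under eq_bigr do rewrite comp_mpolyZ comp_lin_formsX scaler_sumr.
rewrite exchange_big; apply: eq_bigr => j _ /=.
rewrite mderiv_comp_lin_forms raddf_sum scaler_suml; apply: eq_bigr => i _ /=.
rewrite mevalZ meval_comp_lin_forms scalerA mulrC; congr (_ * _ *: _).
by apply: meval_eq => l; rewrite (mul_e0 AP).
Qed.

Lemma std_tangent_form :
  \sum_j ((std_conic k)^`M(j)).@[e0] *: 'X_j = 'X_i2 :> {mpoly k[3]}.
Proof.
rewrite sum_ord3 /std_conic !mderivB !mderivM !mderivXU.
rewrite !mevalB !mevalD !mevalM !mevalC !mevalXU /e0 /=.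
by rewrite !(mulr0,mul0r,mulr1,addr0,add0r,scale0r,scale1r,oppr0,subr0).
Qed.
End HyperosculatingConics.

(** * Stability of even and odd Płoski curves *)

Lemma prod_oapp (R : comPzRingType) (T : finType) (F : T -> R) x :
  \prod_i oapp F x i = x * \prod_i F i.
Proof.
rewrite (bigD1 None) //=; congr (_ * _).
rewrite (reindex_omap Some id) => [|[]//] /=.
by apply: eq_bigl => i; rewrite eqxx.
Qed.

Unset Implicit Arguments.
Local Close Scope ring_scope.

Theorem proposition3p7 (k : closedFieldType) (char0 : [pchar k]%R =i pred0) :
  (forall (n : nat) (h : ternary_form k (2 * n)),
     even_ploski h -> strictly_semistable h) /\
  (forall (n : nat) (h : ternary_form k (2 * n + 1)),
     odd_ploski h -> unstable h).
Proof.
split=> n h [n_gt0 [P [Q]]].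
  move=> [nzP hypQ [_ _ [c nz_c hE]]].
  (* [n >= 1] provides the reference conic, of index 0. *)
  have [A [g [b [uA nz_g _ _ QA]]]] :=
    hyperosculating_normal_form char0 (Ordinal n_gt0) nzP hypQ.
  have hA : mpoly_of_dhomog h \mPo lin_forms A = ((c * g) *: conic_product b)%R.
    by rewrite hE comp_mpolyZ QA scalerA.
  split; first by apply: semistable_normal_form hA; rewrite ?mulf_neq0.
  by case=> _; apply: infinite_stabilizer hA.
move=> [l [nzP hypQ [_ tanl] [_ _ [c nz_c hE]]]].
have [A [g [b [uA nz_g AP Q0 QA]]]] :=
  hyperosculating_normal_form char0 (Ordinal n_gt0) nzP hypQ.
(* Tangency to the reference conic makes [l] a multiple of z in the new coordinates. *)
have [_ [d nz_d lE]] := tanl (Ordinal n_gt0).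
apply: (@unstable_normal_form _ _ b h A (c * d * g)%R uA).
rewrite hE prod_oapp comp_mpolyZ comp_mpolyM QA lE comp_mpolyZ.
by rewrite (comp_tangent_form _ AP) Q0 std_tangent_form -scalerAl -scalerAr !scalerA.
Qed.
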